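(* Let $E\subset[0,1]^n$ be a compact, lower content $(d,c_1)$-regular set with $\operatorname{diam}(E)>0$, and let $\mathcal{D}$ be a system of Christ-David cubes on $E$. Then there exists a measure $\mu$ satisfying the following properties: 1. $\operatorname{supp}\mu=E$; 2. $\mu(E)=\mathcal{H}^d_\infty(E)$; 3. $\mu$ has polynomial growth: there is a constant $C_1\ge1$ such that $\mu(B(x,r))\le C_1r^d$ for all $x\in E$ and $0<r<\operatorname{diam}(E)$; 4. $\mu$ is doubling: there is a constant $C_{db}\ge1$ such that $\mu(B(x,2r))\le C_{db}\,\mu(B(x,r))$ for all $x\in E$ and $0<r<\operatorname{diam}(E)$; 5. the $d$-dimensional density of $\mu$ is almost monotone: there is a constant $A\ge1$ such that if $P,Q\in\mathcal{D}$, $P\subset Q$ and $\ell(Q)\le5\operatorname{diam}(E)$, then $\theta_\mu(P)\le A\,\theta_\mu(Q)$. Here $C_1$ depends only on $d,n$, while $C_{db}$ and $A$ depend only on $d,n$ and $c_1$.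
   Context: $1\le d\le n$ are integers and $c_1>0$. $\mathcal{H}^d_\infty$ is $d$-dimensional Hausdorff content; $B(x,r)$ is the open ball. $E$ is lower content $(d,c_1)$-regular if $\mathcal{H}^d_\infty(E\cap B(x,r))\ge c_1r^d$ for all $x\in E$ and $0<r<\operatorname{diam}(E)$. Christ-David cubes: with $\rho=1/1000$, $c_0=1/500$, a system of Christ-David cubes on $E$ is $\mathcal{D}=\bigcup_{k\in\mathbb{Z}}\mathcal{D}_k$, where each $\mathcal{D}_k$ is a partition of $E$ into disjoint sets (''cubes''); if $Q_1,Q_2\in\mathcal{D}$ intersect then $Q_1\subset Q_2$ or $Q_2\subset Q_1$; and for each $Q\in\mathcal{D}_k$, with $\ell(Q)=5\rho^k$, there is $x_Q\in Q$ with $B(x_Q,c_0\ell(Q))\cap E\subset Q\subset B(x_Q,\ell(Q))$. The density of a cube is $\theta_\mu(Q)=\mu(Q)/\ell(Q)^d$. *)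

(* Defs.v *)
From HB Require Import structures.
From mathcomp Require Import all_boot all_order all_algebra.
From mathcomp Require Import all_classical all_reals all_analysis.

Set Implicit Arguments.
Unset Strict Implicit.
Unset Printing Implicit Defensive.

Import Order.TTheory GRing.Theory Num.Theory.
Import numFieldNormedType.Exports.

Local Open Scope classical_set_scope.
Local Open Scope ring_scope.

(* The norm that the library puts on 'rV[R]_n is the sup norm, so the
   Euclidean distance and its balls are introduced separately.  The topology of
   'rV[R]_n (used for [compact] and [open]) is the usual one. *)
Definition eucl_dist (R : realType) (n : nat) (x y : 'rV[R]_n) : R :=
  Num.sqrt (\sum_(i < n) (x ord0 i - y ord0 i) ^+ 2).

Definition eucl_ball (R : realType) (n : nat) (x : 'rV[R]_n) (r : R) :
    set 'rV[R]_n :=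
  [set y | eucl_dist x y < r].

Definition unit_cube (R : realType) (n : nat) : set 'rV[R]_n :=
  [set x | forall i, 0 <= x ord0 i <= 1].
Arguments unit_cube R n : clear implicits.

(* Extended-real diameter; the outer [maxe 0] only serves to give the empty set
   diameter 0, since [ereal_sup set0] is -oo. *)
Definition eucl_diam (R : realType) (n : nat) (A : set 'rV[R]_n) : \bar R :=
  maxe 0%E (ereal_sup [set e | exists x y, [/\ A x, A y & e = (eucl_dist x y)%:E]]).

(* Hausdorff content is taken without a normalizing constant: the infimum of
   sum_i diam(F_i)^d over all countable covers by arbitrary sets. *)
Definition hausdorff_content (R : realType) (n d : nat) (A : set 'rV[R]_n) :
    \bar R :=
  ereal_inf [set (\sum_(i <oo) eucl_diam (F i) ^+ d)%E |
             F in [set F : nat -> set 'rV[R]_n | A `<=` \bigcup_i F i]].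

Definition lower_content_regular (R : realType) (n d : nat) (c1 : R)
    (E : set 'rV[R]_n) : Prop :=
  forall (x : 'rV[R]_n) (r : R), E x -> 0 < r -> (r%:E < eucl_diam E)%E ->
    ((c1 * r ^+ d)%:E <= hausdorff_content d (E `&` eucl_ball x r))%E.

Definition cd_rho (R : realType) : R := 1 / 1000%:R.

Definition cd_c0 (R : realType) : R := 1 / 500%:R.

(* The side length of the cubes of generation k.  The same set may occur in
   several generations, so side length and density take the generation as an
   argument rather than being read off from the set. *)
Definition cd_ell (R : realType) (k : int) : R := 5%:R * cd_rho R ^ k.

Definition christ_david_cubes (R : realType) (n : nat) (E : set 'rV[R]_n)
    (D : int -> set (set 'rV[R]_n)) : Prop :=
  [/\ forall k : int, partition (D k) id E,
      forall (j k : int) (P Q : set 'rV[R]_n), D j P -> D k Q ->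
        P `&` Q !=set0 -> P `<=` Q \/ Q `<=` P
    & forall (k : int) (Q : set 'rV[R]_n), D k Q ->
        exists x : 'rV[R]_n,
          [/\ Q x,
              eucl_ball x (cd_c0 R * cd_ell R k) `&` E `<=` Q
            & Q `<=` eucl_ball x (cd_ell R k)]].

(* R^n with its Borel sigma-algebra. *)
Notation borel_rV R n := (g_sigma_algebraType (@open 'rV[R]_n)).

Definition msupport (R : realType) (n : nat)
    (mu : {measure set (borel_rV R n) -> \bar R}) : set 'rV[R]_n :=
  [set x | forall U : set 'rV[R]_n, open U -> U x -> (0 < mu U)%E].

(* The density of a cube Q of generation k.  Christ-David cubes are not assumed
   to be Borel, so mu(Q) is read as the value at Q of the outer measure induced
   by mu, which coincides with mu on Borel sets (measurable_mu_extE). *)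
Definition cube_density (R : realType) (n d : nat)
    (mu : {measure set (borel_rV R n) -> \bar R}) (k : int)
    (Q : set 'rV[R]_n) : \bar R :=
  (mu_ext mu Q / (cd_ell R k ^+ d)%:E)%E.

(* Main.v *)
Require Import Defs.
From HB Require Import structures.
From mathcomp Require Import all_boot all_order all_algebra.
From mathcomp Require Import all_classical all_reals all_analysis.
From mathcomp Require Import lra ring zify.
Set Implicit Arguments.
Unset Strict Implicit.
Unset Printing Implicit Defensive.
Import Order.TTheory GRing.Theory Num.Theory.
Import numFieldNormedType.Exports.
Local Open Scope classical_set_scope.
Local Open Scope ring_scope.

(** Frostman's construction, made doubling.  Fix a fine dyadic generation, put
    mass (side length)^d on every cell meeting E and go up through the
    generations, multiplying the mass by a damping factor whenever the cells
    exceed (side length)^d.  A factor constant on cells gives Frostman's lemma,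
    but nearby points in different cells may be damped differently for ever.
    The factor is therefore the largest function below the required reductions
    whose logarithm is Lipschitz at the current scale.  The product of all the
    factors coarser than a given scale then varies by a bounded factor at that
    scale.  A damped point lies near a cell which is still full, so maximal full
    cells give covers of E and the remaining mass bounds the content from above;
    lower regularity then makes the mass that cells of side r carry before the
    coarser dampings comparable to r^d.  So the final mass of a ball B(x,r) is
    comparable to r^d v(x,r), where v is the product of the damping factors
    coarser than r: v is at most 1, is monotone in r, loses a bounded factor
    from one generation to the next and is locally almost constant, whence
    growth, almost monotone density and doubling.

    The limit of finer and finer generations is taken along an ultrafilter, for
    the cell masses and for v; the limiting masses are consistent on the tree of
    cells, and the measure is the image of Lebesgue measure on an interval cut
    into consecutive pieces, of lengths the cell masses, at every generation. *)

(** * Damping at a finite stage *)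

Section FiniteStage.
Context (R : realType) (X : Type) (E : set X) (D : X -> X -> R).
Context (I : finType) (p : I -> X) (b : nat) (l : nat -> X -> nat) (s0 : R).
Context (d : nat).
Hypothesis D_refl : forall x, D x x = 0.
Hypothesis D_sym : forall x y, D x y = D y x.
Hypothesis D_triangle : forall x y z, D x z <= D x y + D y z.
Hypothesis b_gt0 : (0 < b)%N.
Hypothesis s0_gt0 : 0 < s0.
Hypothesis l_parent : forall t x, l t.+1 x = (l t x %/ b)%N.
Hypothesis l_diam : forall t x y, E x -> E y -> l t x = l t y ->
  D x y <= s0 * 2 ^+ t.
Hypothesis p_inj : forall i j, l 0%N (p i) = l 0%N (p j) -> i = j.
Hypothesis p_in : forall i, E (p i).

(* Scales are indexed upwards: [t = 0] is the finest generation. *)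
Definition scale t := s0 * 2 ^+ t.

(** Each sample point [p i] stands for one finest cell, whose mass before any damping is
    [s0 ^+ d]. *)
Definition cell_mass (w : X -> R) t x :=
  \sum_(i | l t (p i) == l t x) s0 ^+ d * w (p i).

Definition cap (w : X -> R) t i :=
  Num.min 1 (scale t ^+ d / cell_mass w t (p i)).

(** Multiplicative form of the McShane envelope: among functions at most 1 whose logarithm is
    Lipschitz with constant [1 / scale t], the largest one lying below [cap] at every sample
    point. *)
Definition damping (w : X -> R) t x :=
  \big[Num.min/1]_i (cap w t i * expR (D x (p i) / scale t)).

Fixpoint weight t : X -> R :=
  if t is t'.+1 then fun x => weight t' x * damping (weight t') t'.+1 x
  else fun=> 1.

Lemma D_ge0 x y : 0 <= D x y.
Proof. by have := D_triangle x y x; rewrite D_refl (D_sym y x); lra. Qed.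

Lemma scale_gt0 t : 0 < scale t.
Proof. by rewrite mulr_gt0 ?exprn_gt0. Qed.

Lemma scaleS t : scale t.+1 = 2 * scale t.
Proof. by rewrite /scale exprS; ring. Qed.

Lemma scale_le t u : (t <= u)%N -> scale t <= scale u.
Proof.
move=> tu; rewrite /scale ler_pM2l //.
by rewrite ler_weXn2l // ler1n.
Qed.

Lemma l_coarsen t u x y : (t <= u)%N -> l t x = l t y -> l u x = l u y.
Proof.
move=> /subnK <-; elim: (u - t)%N => [//|k IH] /IH e.
by rewrite addSn !l_parent e.
Qed.

Lemma eq_cell_mass w t x y : l t x = l t y -> cell_mass w t x = cell_mass w t y.
Proof. by move=> e; rewrite /cell_mass e. Qed.

Lemma cell_mass_gt0 w t i : (forall y, 0 < w y) -> 0 < cell_mass w t (p i).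
Proof.
move=> w0; rewrite /cell_mass (bigD1 i) //= ltr_pwDl //.
  by rewrite mulr_gt0 // exprn_gt0.
by apply: sumr_ge0 => j _; rewrite mulr_ge0 ?exprn_ge0 ?ltW.
Qed.

(** The indices in a parent cell are sorted by the residue of their label modulo [b]; each class is
    empty or exactly one child. *)
Lemma cell_mass_parent w t x B : 0 <= B -> (forall y, cell_mass w t y <= B) ->
  cell_mass w t.+1 x <= b%:R * B.
Proof.
move=> B0 wB; rewrite /cell_mass.
pose dig (i : I) : 'I_b := Ordinal (ltn_pmod (l t (p i)) b_gt0).
rewrite (partition_big dig predT) //=.
rewrite mulr_natl -[b in leRHS]card_ord -sumr_const.
apply: ler_sum => a _.
have [[i0 /andP[i0x i0a]]|no] :=
  pselect (exists i, (l t.+1 (p i) == l t.+1 x) && (dig i == a)).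
  apply: le_trans (wB (p i0)); rewrite /cell_mass le_eqVlt; apply/orP; left.
  apply/eqP/eq_bigl => i; move: i0x i0a; rewrite !l_parent => /eqP i0x /eqP <-.
  apply/andP/eqP => [[/eqP e1 /eqP [e2]]|e].
    by rewrite (divn_eq (l t (p i)) b) e1 e2 -i0x -divn_eq.
  by split; [rewrite e i0x|apply/eqP/val_inj => /=; rewrite e].
rewrite big1 // => i hi; exfalso; apply: no; by exists i.
Qed.

Lemma damping_le1 w t x : damping w t x <= 1.
Proof. exact: bigmin_le_id. Qed.

Lemma damping_le_cap w t i : damping w t (p i) <= cap w t i.
Proof.
apply: (@bigmin_inf _ _ _ _ i) => //.
by rewrite D_refl mul0r expR0 mulr1.
Qed.

(** The cap depends only on the cell, so on a whole cell the damping is at most one number, chosen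
    to bring the mass down to [scale t ^+ d]. *)
Lemma cell_mass_damping w t x : (forall y, 0 < w y) ->
  cell_mass (fun y => w y * damping w t y) t x <= scale t ^+ d.
Proof.
move=> w0.
have [[i0 i0x]|no] := pselect (exists i, l t (p i) = l t x); last first.
  rewrite /cell_mass big1 ?exprn_ge0 ?ltW ?scale_gt0 // => i /eqP hi.
  by exfalso; apply: no; exists i.
rewrite -(eq_cell_mass _ i0x).
have m0 := cell_mass_gt0 t i0 w0.
apply: (@le_trans _ _ (cell_mass w t (p i0) * cap w t i0)); last first.
  rewrite /cap mulrC -ler_pdivlMr //.
  by rewrite ge_min lexx orbT.
rewrite /cell_mass mulr_suml; apply: ler_sum => i /eqP hi.
rewrite mulrA ler_pM2l ?mulr_gt0 ?exprn_gt0 //.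
apply: (le_trans (damping_le_cap w t i)).
by rewrite /cap (eq_cell_mass w hi).
Qed.

Lemma cap_ge w t i : (forall y, 0 < w y) ->
  (forall y, cell_mass w t y <= b%:R * scale t ^+ d) -> b%:R^-1 <= cap w t i.
Proof.
move=> w0 wB; rewrite /cap le_min invf_le1 ?ltr0n // ler1n b_gt0 /=.
have m0 := cell_mass_gt0 t i w0.
by rewrite ler_pdivlMr // ler_pdivrMl ?ltr0n.
Qed.

Lemma damping_ge w t x : (forall y, 0 < w y) ->
  (forall y, cell_mass w t y <= b%:R * scale t ^+ d) -> b%:R^-1 <= damping w t x.
Proof.
move=> w0 wB; apply: le_bigmin => [|i _].
  by rewrite invf_le1 ?ltr0n // ler1n.
apply: (le_trans (cap_ge i w0 wB)).
rewrite ler_peMr //.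
  by apply: le_trans (cap_ge i w0 wB); rewrite invr_ge0 ler0n.
by rewrite -expR0 ler_expR divr_ge0 ?D_ge0 ?ltW ?scale_gt0.
Qed.

(** The three bounds go through one induction: the bound on the next generation keeps the caps above
    [1 / b], hence the next weight positive, and damping restores the bound [scale t ^+ d]. *)
Lemma weight_inv t :
  [/\ forall x, 0 < weight t x, forall x, cell_mass (weight t) t x <= scale t ^+ d
    & forall x, cell_mass (weight t) t.+1 x <= b%:R * scale t.+1 ^+ d].
Proof.
have aux u : (forall x, cell_mass (weight u) u x <= scale u ^+ d) ->
    forall x, cell_mass (weight u) u.+1 x <= b%:R * scale u.+1 ^+ d.
  move=> h x; apply: (@le_trans _ _ (b%:R * scale u ^+ d)).
    by apply: cell_mass_parent => //; rewrite exprn_ge0 ?ltW ?scale_gt0.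
  rewrite ler_pM2l ?ltr0n //.
  by apply: lerXn2r; rewrite ?nnegrE ?scale_le // ltW ?scale_gt0.
elim: t => [|t [w0 wt wt1]] /=.
  have h x : cell_mass (fun=> 1) 0 x <= scale 0 ^+ d.
    have [[i0 i0x]|no] := pselect (exists i, l 0 (p i) = l 0 x); last first.
      rewrite /cell_mass big1 ?exprn_ge0 ?ltW ?scale_gt0 // => i /eqP hi.
      by exfalso; apply: no; exists i.
    rewrite /cell_mass (bigD1 i0) /= ?i0x // big1 ?addr0 => [|i /andP[/eqP e /eqP ne]].
      by rewrite /scale expr0 !mulr1.
    by case: ne; apply: p_inj; rewrite e.
  by split => //; apply: aux.
have h x := cell_mass_damping t.+1 x w0.
split => // [x|]; last exact: aux.
by rewrite mulr_gt0 // (lt_le_trans _ (damping_ge x w0 wt1)) // invr_gt0 ltr0n.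
Qed.

Lemma weight_gt0 t x : 0 < weight t x.
Proof. by case: (weight_inv t). Qed.

Lemma cell_mass_weight t x : cell_mass (weight t) t x <= scale t ^+ d.
Proof. by case: (weight_inv t). Qed.

Lemma damping_weight_ge t x : b%:R^-1 <= damping (weight t) t.+1 x.
Proof. by case: (weight_inv t) => w0 _ wB; apply: damping_ge. Qed.

Lemma weightS_le t x : weight t.+1 x <= weight t x.
Proof. by rewrite /= ger_pMr ?weight_gt0 // damping_le1. Qed.

Lemma weightS_ge t x : weight t x <= b%:R * weight t.+1 x.
Proof.
rewrite /= mulrCA ler_pMr ?weight_gt0 // -ler_pdivrMl ?ltr0n // mulr1.
exact: damping_weight_ge.
Qed.

Lemma weight_le t u x : (t <= u)%N -> weight u x <= weight t x.
Proof.
move=> /subnK <-; elim: (u - t)%N => [//|k IH].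
by apply: le_trans IH; rewrite addSn weightS_le.
Qed.

Lemma damping_lip t x y : damping (weight t) t.+1 x <=
  damping (weight t) t.+1 y * expR (D x y / scale t.+1).
Proof.
have [w0 _ wB] := weight_inv t.
rewrite -ler_pdivrMr ?expR_gt0 //; apply: le_bigmin => [|i _].
  rewrite ler_pdivrMr ?expR_gt0 // mul1r (le_trans (damping_le1 _ _ _)) //.
  by rewrite -expR0 ler_expR divr_ge0 ?D_ge0 ?ltW ?scale_gt0.
rewrite ler_pdivrMr ?expR_gt0 // -mulrA -expRD -mulrDl.
apply: (@bigmin_inf _ _ _ _ i) => //.
rewrite ler_pM2l ?ler_expR ?ler_pM2r ?invr_gt0 ?scale_gt0 //.
  by rewrite addrC D_triangle.
by apply: (lt_le_trans _ (cap_ge i w0 wB)); rewrite invr_gt0 ltr0n.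
Qed.

(* Log-Lipschitz constants of the successive damping factors form a geometric
   series: 1/s_{t+1} + ... + 1/s_T = 1/s_t - 1/s_T. *)
Lemma weight_ratio t T x y : (t <= T)%N ->
  weight T x * weight t y <= weight T y * weight t x * expR (D x y / scale t).
Proof.
move=> tT.
suff: weight T x * weight t y <=
    weight T y * weight t x * expR (D x y * ((scale t)^-1 - (scale T)^-1)).
  move=> /le_trans; apply; rewrite ler_pM2l ?mulr_gt0 ?weight_gt0 //.
  rewrite ler_expR; apply: ler_wpM2l; first exact: D_ge0.
  by rewrite gerBl invr_ge0 ltW ?scale_gt0.
move/subnK: tT => <-; elim: (T - t)%N => [|k IH].
  by rewrite add0n subrr mulr0 expR0 mulr1 mulrC.
rewrite addSn /=; set T' := (k + t)%N in IH *.
have g0 : 0 <= damping (weight T') T'.+1 x.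
  by apply: le_trans (damping_weight_ge T' x); rewrite invr_ge0 ler0n.
have w0 : 0 <= weight T' x * weight t y by rewrite ltW // mulr_gt0 ?weight_gt0.
have h := ler_pM w0 g0 IH (damping_lip T' x y).
rewrite mulrAC; apply: (le_trans h).
rewrite le_eqVlt; apply/orP; left; apply/eqP.
rewrite scaleS; set e := expR (_ * (_ - (2 * _)^-1)).
have -> : e = expR (D x y * ((scale t)^-1 - (scale T')^-1)) *
              expR (D x y / (2 * scale T')).
  rewrite -expRD; congr expR; field.
  by rewrite !gt_eqF ?scale_gt0.
ring.
Qed.

(** The minimum is reached at some [i] with cap below 1, so the cell of [p i] was overfull, and
    damping takes away at most a factor [b]. As the cap is at least [1 / b], the exponential is
    below [b], and [1 + u <= expR u] bounds the distance. *)
Lemma damping_lt1 t x : damping (weight t) t.+1 x < 1 ->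
  exists i, D x (p i) <= b%:R * scale t.+1 /\
    scale t.+1 ^+ d / b%:R <= cell_mass (weight t.+1) t.+1 (p i).
Proof.
have [w0 _ wB] := weight_inv t.
move=> /bigmin_ltP [|[i _ hi]]; first by rewrite ltxx.
have c0 := cap_ge i w0 wB.
have D0 : 0 <= D x (p i) / scale t.+1.
  by rewrite divr_ge0 ?D_ge0 ?ltW ?scale_gt0.
have b0 : 0 < b%:R^-1 :> R by rewrite invr_gt0 ltr0n.
exists i; split.
  rewrite -ler_pdivrMr ?scale_gt0 //.
  have h1 : b%:R^-1 * expR (D x (p i) / scale t.+1) < 1.
    by apply: le_lt_trans hi; rewrite ler_pM2r ?expR_gt0.
  rewrite mulrC -ltr_pdivlMr // div1r invrK in h1.
  apply: ltW; apply: le_lt_trans h1.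
  by apply: le_trans (expR_ge1Dx _); rewrite lerDr.
have cap1 : cap (weight t) t.+1 i < 1.
  apply: le_lt_trans hi; rewrite ler_peMr ?(le_trans (ltW b0)) //.
  by rewrite -expR0 ler_expR.
have m0 := cell_mass_gt0 t.+1 i w0.
have : scale t.+1 ^+ d < cell_mass (weight t) t.+1 (p i).
  by move: cap1; rewrite /cap gt_min ltxx /= ltr_pdivrMr // mul1r.
move=> /ltW h; rewrite ler_pdivrMr ?ltr0n //; apply: (le_trans h).
rewrite /cell_mass mulr_suml; apply: ler_sum => j _.
rewrite -mulrA ler_pM2l ?exprn_gt0 // mulrC.
exact: weightS_ge.
Qed.

(** Here [t] is the last stage at which [p i] was really damped. If there is none, [t = 0] works
    with the finest cell of [p i] itself. *)
Lemma last_damping T i : exists t j, [/\ (t <= T)%N,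
  D (p i) (p j) <= b%:R * scale t, weight T (p i) = weight t (p i)
  & scale t ^+ d / b%:R <= cell_mass (weight t) t (p j)].
Proof.
elim: T => [|T [t [j [tT hD hw hm]]]].
  exists 0%N, i; split => //.
    by rewrite D_refl mulr_ge0 ?ler0n ?ltW ?scale_gt0.
  rewrite /cell_mass (bigD1 i) //= ler_wpDr //.
    by apply: sumr_ge0 => j _; rewrite mulr_ge0 ?exprn_ge0 ?ltW.
  rewrite /scale expr0 !mulr1 ler_pdivrMr ?ltr0n // ler_peMr ?ler1n //.
  by rewrite exprn_ge0 // ltW.
have [h|h] := ltP (damping (weight T) T.+1 (p i)) 1.
  by have [j' [? ?]] := damping_lt1 h; exists T.+1, j'; split.
exists t, j; split => //; first exact: leqW.
rewrite /= -hw -[RHS]mulr1; congr (_ * _); apply/eqP.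
by rewrite eq_le h damping_le1.
Qed.

(** The factor [1 / b] is the fullness left by [last_damping]; the exponential is the ratio of
    weights over a distance [(b + 1) * scale t]. *)
Definition heavy_const : R := expR (- (b%:R + 1)) / b%:R.

Definition heavy T t i :=
  heavy_const * scale t ^+ d <= cell_mass (weight T) t (p i).

Lemma heavy_const_gt0 : 0 < heavy_const.
Proof. by rewrite divr_gt0 ?expR_gt0 ?ltr0n. Qed.

(** Stages after the last damping leave [p i] untouched. By [weight_ratio] they can then lower the
    weights in the nearby full cell only by a bounded factor, so that cell is still heavy at stage
    [T]. *)
Lemma heavy_near T i : exists t j,
  [/\ (t <= T)%N, D (p i) (p j) <= b%:R * scale t & heavy T t j].
Proof.
have [t [j [tT hD hw hm]]] := last_damping T i.
exists t, j; split => //; rewrite /heavy /heavy_const -mulrA mulrC -ler_pdivlMr ?expR_gt0 //.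
rewrite mulrC; apply: (le_trans hm); rewrite -expRN opprK /cell_mass mulr_suml.
apply: ler_sum => k /eqP hk; rewrite -mulrA ler_pM2l ?exprn_gt0 //.
have := weight_ratio (p i) (p k) tT; rewrite hw mulrC -mulrA (mulrC _ (expR _)) mulrA.
move=> h; have {h}: weight t (p k) <= weight T (p k) * expR (D (p i) (p k) / scale t).
  rewrite -(ler_pM2r (weight_gt0 t (p i))); apply: (le_trans h).
  by rewrite le_eqVlt; apply/orP; left; apply/eqP; ring.
move=> /le_trans; apply; rewrite ler_pM2l ?weight_gt0 // ler_expR.
rewrite ler_pdivrMr ?scale_gt0 // mulrDl mul1r.
apply: le_trans (D_triangle _ (p j) _) _; apply: lerD => //.
by apply: l_diam.
Qed.

(* Maximal heavy cells are disjoint; [rep] selects one index in each of them. *)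
Lemma heavy_cover T (A : set X) :
  A `<=` E -> (forall y, A y -> exists i, l 0 (p i) = l 0 y) ->
  exists (S : {set I}) (h : I -> nat),
    (forall y, A y -> exists2 i, i \in S & D y (p i) <= (b%:R + 2) * scale (h i)) /\
    heavy_const * \sum_(i in S) scale (h i) ^+ d <=
      \sum_(j | `[< exists2 y, A y & D y (p j) <= (b%:R + 3) * scale T >])
         s0 ^+ d * weight T (p j).
Proof.
move=> AE Ap.
pose hvy i := [exists t : 'I_T.+1, heavy T t i].
pose top i := (\max_(t < T.+1 | heavy T t i) t)%N.
pose key i := (top i, l (top i) (p i)).
pose rep i := odflt i [pick j | hvy j && (key j == key i)].
have top_le i : (top i <= T)%N by apply/bigmax_leqP => t _; rewrite -ltnS.
have le_top t i : (t <= T)%N -> heavy T t i -> (t <= top i)%N.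
  by rewrite -ltnS => tT hti; exact: (@leq_bigmax_cond _ _ _ (Ordinal tT)).
have heavy_top i : hvy i -> heavy T (top i) i.
  move=> /existsP[t0 ht0]; rewrite /top.
  have [|t ht ->] := @eq_bigmax_cond 'I_T.+1 (fun t => heavy T t i) (fun t => nat_of_ord t).
    by apply/card_gt0P; exists t0.
  exact: ht.
have hvyI t i : (t <= T)%N -> heavy T t i -> hvy i.
  by rewrite -ltnS => tT hti; apply/existsP; exists (Ordinal tT).
have repP i : hvy i -> hvy (rep i) /\ key (rep i) = key i.
  by move=> hi; rewrite /rep; case: pickP => [j /andP[? /eqP]|/(_ i)].
have eq_rep i j : hvy i -> key i = key j -> rep i = rep j.
  move=> hi e; rewrite /rep e; case: pickP => [j' _ //|/(_ i)].
  by rewrite hi e eqxx.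
have key_cell i j : key i = key j -> D (p i) (p j) <= scale (top i).
  by case=> e; rewrite -e => e'; exact: l_diam.
(* One representative for each maximal heavy cell that comes close to [A]; [top] gives the stage of
   that cell. *)
exists [set u | [&& hvy u, rep u == u &
  `[< exists2 y, A y & D y (p u) <= (b%:R + 2) * scale (top u) >]]]%SET, top.
split=> [y Ay|].
  have [i0 hi0] := Ap _ Ay.
  have [t [j [tT hD hj]]] := heavy_near T i0.
  have vj := hvyI _ _ tT hj.
  have [vu ku] := repP _ vj.
  have tu : top (rep j) = top j by case: ku.
  (* One scale from [y] to its sample point, [b] to the heavy cell, one more inside the maximal
     heavy cell: [b + 2]. *)
  have yu : D y (p (rep j)) <= (b%:R + 2) * scale (top (rep j)).
    have h1 : D y (p i0) <= scale 0.
      by apply: l_diam => //; exact: AE.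
    have h2 : D (p j) (p (rep j)) <= scale (top j) by apply: key_cell.
    have h3 := scale_le (le_top _ _ tT hj).
    have h4 := scale_le (leq0n t).
    have h5 := D_triangle y (p i0) (p (rep j)).
    have h6 := D_triangle (p i0) (p j) (p (rep j)).
    have h7 : b%:R * scale t <= b%:R * scale (top j) by rewrite ler_wpM2l.
    rewrite tu; lra.
  exists (rep j) => //; rewrite inE vu /=; apply/andP; split; last first.
    by apply/asboolP; exists y.
  by apply/eqP; apply: eq_rep.
set S := [set u | _]%SET; set near := (X in _ <= \sum_(j | X j) _).
pose F j := s0 ^+ d * weight T (p j).
have F0 j : 0 <= F j by rewrite mulr_ge0 ?exprn_ge0 ?ltW // weight_gt0.
apply: (@le_trans _ _ (\sum_(j | near j && (rep j \in S)) F j)); last first.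
  rewrite [leRHS](bigID (fun j => rep j \in S)) /= lerDl.
  by apply: sumr_ge0 => j _; exact: F0.
rewrite [leRHS](partition_big rep (mem S)) /= => [|j /andP[] //].
rewrite mulr_sumr; apply: ler_sum => u uS.
move: (uS); rewrite finset.inE => /and3P[vu /eqP ru /asboolP[y Ay yu]].
apply: (le_trans (heavy_top _ vu)).
(* Two indices in the same maximal heavy cell have the same [top], hence the same representative. So
   the whole mass of the cell of [u] lies in the fibre of [rep] over [u], and these fibres are
   disjoint. The diameter of the cell raises [b + 2] to [b + 3]. *)
have cellP j : l (top u) (p j) == l (top u) (p u) -> near j && (rep j \in S) && (rep j == u).
  move=> /eqP e.
  have hj : heavy T (top u) j.
    by rewrite /heavy (eq_cell_mass _ e); exact: heavy_top.
  have le1 := le_top _ _ (top_le u) hj.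
  have vj := hvyI _ _ (top_le u) hj.
  have e' := l_coarsen le1 e.
  have hu : heavy T (top j) u.
    by rewrite /heavy -(eq_cell_mass _ e'); exact: heavy_top.
  have le2 := le_top _ _ (top_le j) hu.
  have et : top j = top u by apply/eqP; rewrite eqn_leq le1 le2.
  have kj : key j = key u by rewrite /key et e.
  have rj : rep j = u by rewrite (eq_rep _ _ vj kj).
  rewrite rj uS eqxx !andbT /near; apply/asboolP; exists y => //.
  have h1 : D (p u) (p j) <= scale (top u) by apply: l_diam.
  have h2 := D_triangle y (p u) (p j).
  have h3 : (b%:R + 3) * scale (top u) <= (b%:R + 3) * scale T.
    by rewrite ler_wpM2l ?scale_le //; apply: addr_ge0; rewrite ?ler0n.
  lra.
rewrite /cell_mass big_mkcond [leRHS]big_mkcond; apply: ler_sum => j _.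
case: ifP => [/cellP -> //|_]; case: ifP => // _; exact: F0.
Qed.

End FiniteStage.

(** * Hausdorff content *)

Section EuclideanSup.
Context (R : realType) (n : nat).
Implicit Types x y : 'rV[R]_n.

Lemma coord_le_norm x i : `|x ord0 i| <= `|x|.
Proof.
rewrite {2}/Num.norm /= mx_normrE; apply/bigmax_geP; right => /=.
by exists (ord0, i).
Qed.

Lemma norm_le_coord x (r : R) : 0 <= r -> (forall i, `|x ord0 i| <= r) -> `|x| <= r.
Proof.
move=> r0 xr; rewrite {1}/Num.norm /= mx_normrE; apply/bigmax_leP; split => //.
by move=> [i j] _ /=; rewrite ord1.
Qed.

Lemma eucl_dist_ge0 x y : 0 <= eucl_dist x y.
Proof. exact: sqrtr_ge0. Qed.

Lemma norm_le_eucl x y : `|x - y| <= eucl_dist x y.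
Proof.
apply: norm_le_coord => [|i]; first exact: eucl_dist_ge0.
rewrite !mxE -sqrtr_sqr; apply: ler_wsqrtr.
rewrite (bigD1 i) //= lerDl; apply: sumr_ge0 => j _; exact: sqr_ge0.
Qed.

Lemma eucl_le_norm x y : eucl_dist x y <= n%:R * `|x - y|.
Proof.
rewrite -[leRHS]ger0_norm ?mulr_ge0 // -sqrtr_sqr; apply: ler_wsqrtr.
have h i : (x ord0 i - y ord0 i) ^+ 2 <= `|x - y| ^+ 2.
  rewrite -real_normK ?num_real //; apply: lerXn2r; rewrite ?nnegrE //.
  by have := coord_le_norm (x - y) i; rewrite !mxE.
apply: (@le_trans _ _ (\sum_(i < n) `|x - y| ^+ 2)).
  by apply: ler_sum => i _; exact: h.
rewrite sumr_const card_ord exprMn -[leLHS]mulr_natl; apply: ler_wpM2r; first exact: sqr_ge0.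
by rewrite -natrX ler_nat; case: (n) => // k; rewrite expnS expn1 leq_pmulr.
Qed.

Lemma eucl_ball_open x (r : R) : open (eucl_ball x r).
Proof.
have cont : continuous (fun y => eucl_dist x y).
  move=> y; rewrite /eucl_dist.
  apply: continuous_comp; last exact: sqrt_continuous.
  apply: (@cvg_big _ _ +%R) => [| |i _]; [exact: add_continuous|exact: nbhs_filter|].
  apply: (@continuous_comp _ _ _ (fun z : 'rV[R]_n => x ord0 i - z ord0 i)
    (fun u : R => u ^+ 2)); last exact: exprn_continuous.
  by apply: continuousB; [exact: cst_continuous | exact: coord_continuous].
have := @open_comp _ _ (fun y => eucl_dist x y) [set z | z < r] (fun y _ => cont y).
by apply; exact: open_lt.
Qed.

Lemma eucl_diam_ge (A : set 'rV[R]_n) x y : A x -> A y ->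
  ((eucl_dist x y)%:E <= eucl_diam A)%E.
Proof.
move=> Ax Ay; rewrite /eucl_diam le_max; apply/orP; right.
by apply: ereal_sup_ubound; exists x, y.
Qed.

Lemma eucl_diam_le (A : set 'rV[R]_n) (r : R) : 0 <= r ->
  (forall x y, A x -> A y -> eucl_dist x y <= r) -> (eucl_diam A <= r%:E)%E.
Proof.
move=> r0 h; rewrite /eucl_diam ge_max lee_fin r0 /=.
by apply: ge_ereal_sup => _ [x [y [Ax Ay ->]]]; rewrite lee_fin h.
Qed.

Lemma eucl_diam_ge0 (A : set 'rV[R]_n) : (0 <= eucl_diam A)%E.
Proof. by rewrite /eucl_diam le_max lexx. Qed.

Lemma eucl_diam0 : eucl_diam (@set0 'rV[R]_n) = 0%E.
Proof.
by apply/eqP; rewrite eq_le eucl_diam_ge0 andbT; apply: eucl_diam_le.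
Qed.

Lemma expe_le (a b : \bar R) k : (0 <= a)%E -> (a <= b)%E -> (a ^+ k <= b ^+ k)%E.
Proof.
move=> a0 ab; elim: k => [|k IH]; first by rewrite !expe0.
by rewrite !expeS; apply: lee_pmul => //; exact: expe_ge0.
Qed.

(** A sup-norm ball of radius [r] has Euclidean diameter at most [2 * n * r]. The finite cover is
    extended to a sequence by empty sets. *)
Lemma content_finite_cover (d : nat) (A : set 'rV[R]_n) (J : finType)
    (S : {set J}) (q : J -> 'rV[R]_n) (rad : J -> R) : (0 < d)%N ->
  (forall i, 0 <= rad i) ->
  (forall y, A y -> exists2 i, i \in S & `|y - q i| <= rad i) ->
  (hausdorff_content d A <= (\sum_(i in S) (2 * n%:R * rad i) ^+ d)%:E)%E.
Proof.
move=> d0 rad0 cov.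
pose G (o : option J) := if o is Some i then [set y | `|y - q i| <= rad i] else set0.
pose s := [seq Some i | i <- enum S].
pose F k := G (nth None s k).
apply: (@le_trans _ _ (\sum_(k <oo) eucl_diam (F k) ^+ d)%E).
  apply: ereal_inf_lbound; exists F => //= y /cov [i iS yi].
  exists (index (Some i) s) => //; rewrite /F nth_index //.
  by apply: map_f; rewrite mem_enum.
have term0 k : (0 <= eucl_diam (F k) ^+ d)%E by apply: expe_ge0; exact: eucl_diam_ge0.
rewrite (@nneseries_split _ _ 0 (size s)) //.
(* The empty sets of the tail contribute [0 ^+ d], which is 0 because [d] is positive. *)
rewrite [X in (_ + X)%E]eseries0 ?adde0; last first.
  move=> k; rewrite add0n => ks _; rewrite /F nth_default //= eucl_diam0.
  by rewrite -(prednK d0) expeS mul0e.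
rewrite add0n -(big_nth None predT (fun o => (eucl_diam (G o) ^+ d)%E)).
rewrite big_map big_enum /= -sumEFin; apply: lee_sum => i _.
rewrite EFin_expe; apply: expe_le; first exact: eucl_diam_ge0.
apply: eucl_diam_le => [|x y /= xi yi]; first by rewrite !mulr_ge0.
apply: (le_trans (eucl_le_norm x y)); rewrite mulrC mulrAC [leRHS]mulrC.
rewrite [leLHS]mulrC; apply: ler_wpM2l => //.
rewrite (_ : x - y = (x - q i) - (y - q i)); last by rewrite opprB addrA subrK.
by apply: (le_trans (ler_normB _ _)); lra.
Qed.

End EuclideanSup.

(** * Dyadic cells *)

Section DyadicCells.
Context (R : realType) (n : nat) (E : set 'rV[R]_n) (x0 : 'rV[R]_n) (delta : R).
Hypothesis delta_gt0 : 0 < delta.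
Hypothesis E_bounded : forall x, E x -> `|x - x0| <= delta.

Definition branching := #|{ffun 'I_n -> bool}|.

(** The root side [8 * delta] leaves room around [E]: it exceeds the side [5 * delta] of the largest
    cubes considered, and already [mesh 1] exceeds every radius below the diameter. *)
Definition mesh k : R := 8 * delta / 2 ^+ k.

(** The shift by [1 / 2] centres the root cell at [x0]; on [E] the argument is nonnegative, so
    truncation to a natural number is the floor. *)
Definition grid_coord k (x : 'rV[R]_n) i : nat :=
  Num.truncn (2 ^+ k * ((x ord0 i - x0 ord0 i) / (8 * delta) + 1 / 2)).

Definition digit k x : 'I_branching :=
  enum_rank [ffun i => odd (grid_coord k x i)].

(* Morton code: the cells of one generation are numbered so that the children
   of a cell form a block of [branching] consecutive integers. *)
Fixpoint label k x : nat :=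
  if k is k'.+1 then (branching * label k' x + digit k'.+1 x)%N else 0%N.

Lemma branching_gt0 : (0 < branching)%N.
Proof. by apply/card_gt0P; exists [ffun=> true]. Qed.

Lemma mesh_gt0 k : 0 < mesh k.
Proof. by rewrite /mesh divr_gt0 ?exprn_gt0 // mulr_gt0. Qed.

Lemma meshS k : mesh k = 2 * mesh k.+1.
Proof. by rewrite /mesh exprS; field; rewrite expf_neq0. Qed.

Lemma mesh_le k m : (k <= m)%N -> mesh m <= mesh k.
Proof.
move=> /subnK <-; elim: (m - k)%N => [//|j IH].
rewrite addSn; apply: le_trans IH; rewrite [leRHS]meshS.
by have := mesh_gt0 (j + k).+1; lra.
Qed.

Lemma mesh0 : mesh 0 = 8 * delta.
Proof. by rewrite /mesh expr0 divr1. Qed.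

Lemma meshD k j : mesh k = 2 ^+ j * mesh (k + j).
Proof.
elim: j => [|j IH]; first by rewrite expr0 mul1r addn0.
by rewrite IH addnS meshS exprSr mulrA.
Qed.

Lemma mesh_small (e : R) : 0 < e -> exists k, mesh k < e.
Proof.
move=> e0; have h : 0 <= 8 * delta / e by rewrite divr_ge0 ?ltW // mulr_gt0.
exists (Num.bound (8 * delta / e)); rewrite /mesh ltr_pdivrMr ?exprn_gt0 //.
rewrite [ltRHS]mulrC -ltr_pdivrMr //; apply: (lt_le_trans (archi_boundP h)).
by rewrite -natrX ler_nat ltnW // ltn_expl.
Qed.

Lemma mesh_bracket (r : R) : 0 < r -> r <= mesh 0 ->
  exists k, mesh k.+1 < r <= mesh k.
Proof.
move=> r0 r8.
have [k /= kr kmin] := ex_minnP (mesh_small r0).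
case: k kr kmin => [|k] kr kmin; first by move: kr; rewrite ltNge r8.
exists k; rewrite kr /= leNgt; apply/negP => /kmin; by rewrite ltnn.
Qed.

Lemma grid_arg_bounds x i : E x ->
  0 <= (x ord0 i - x0 ord0 i) / (8 * delta) + 1 / 2 < 1.
Proof.
move=> /E_bounded xd; have := coord_le_norm (x - x0) i; rewrite !mxE.
move=> /le_trans /(_ xd); rewrite ler_norml => /andP[h1 h2].
set w := _ / (8 * delta).
have d8 : 0 < 8 * delta by rewrite mulr_gt0.
have e : w * (8 * delta) = x ord0 i - x0 ord0 i by rewrite divfK // gt_eqF.
apply/andP; split; nra.
Qed.

Lemma grid_coord_bounds k x i : E x ->
  (grid_coord k x i)%:R <= 2 ^+ k * ((x ord0 i - x0 ord0 i) / (8 * delta) + 1 / 2)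
    < (grid_coord k x i)%:R + 1.
Proof.
move=> Ex; have /andP[h _] := grid_arg_bounds i Ex.
by rewrite natr1; apply: truncn_itv; rewrite mulr_ge0 ?exprn_ge0.
Qed.

Lemma grid_coord0 x i : E x -> grid_coord 0 x i = 0%N.
Proof.
move=> Ex; apply: truncn_def; rewrite expr0 mul1r.
exact: grid_arg_bounds.
Qed.

Lemma grid_coord_half k x i : E x -> (grid_coord k.+1 x i)./2 = grid_coord k x i.
Proof.
move=> Ex; apply/esym/truncn_def.
have := grid_coord_bounds k.+1 i Ex; rewrite exprS -mulrA.
set w := 2 ^+ k * _; set z := grid_coord k.+1 x i => /andP[h1 h2].
have := odd_double_half z; rewrite -muln2 => e.
have : (odd z <= 1)%N by case: (odd z).
move: e h1 h2; move: (nat_of_bool (odd z)) (z./2) => o h <-.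
rewrite natrD natrM -(@ler_nat R) -natr1 => h1 h2 h3.
have o0 : 0 <= o%:R :> R by [].
by apply/andP; split; lra.
Qed.

Lemma label_parent k x : label k x = (label k.+1 x %/ branching)%N.
Proof.
by rewrite /= mulnC divnMDl ?branching_gt0 // divn_small ?addn0.
Qed.

Lemma label_lt k x : (label k x < branching ^ k)%N.
Proof.
elim: k => [//|k IH] /=; rewrite expnS.
apply: (@leq_trans (branching * (label k x).+1)); last by rewrite leq_mul2l IH orbT.
by rewrite mulnS addnC ltn_add2r.
Qed.

(** A grid coordinate is determined by its half, the coordinate in the parent generation, and its
    parity, which the digit records. *)
Lemma eq_labelP k x y : E x -> E y ->
  label k x = label k y <-> grid_coord k x =1 grid_coord k y.
Proof.
move=> Ex Ey; elim: k => [|k [IH1 IH2]].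
  by split=> // _ i; rewrite !grid_coord0.
split=> [e i|e].
  have e0 : label k x = label k y by rewrite label_parent e -label_parent.
  have ed : digit k.+1 x = digit k.+1 y.
    by apply/val_inj/eqP; move/eqP: e; rewrite /= e0 eqn_add2l.
  have eo : odd (grid_coord k.+1 x i) = odd (grid_coord k.+1 y i).
    by move/enum_rank_inj: ed => /ffunP /(_ i); rewrite !ffunE.
  rewrite -(odd_double_half (grid_coord k.+1 x i)).
  by rewrite eo (grid_coord_half _ _ Ex) IH1 // -(grid_coord_half k i Ey) odd_double_half.
rewrite /= IH2 => [|i]; last first.
  by rewrite -(grid_coord_half k i Ex) -(grid_coord_half k i Ey) e.
congr (_ + nat_of_ord (enum_rank _))%N.
by apply/ffunP => i; rewrite !ffunE e.
Qed.

Lemma label_diam k x y : E x -> E y -> label k x = label k y -> `|x - y| <= mesh k.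
Proof.
move=> Ex Ey /(eq_labelP _ Ex Ey) e; apply: norm_le_coord => [|i].
  exact/ltW/mesh_gt0.
rewrite !mxE; have := grid_coord_bounds k i Ex; have := grid_coord_bounds k i Ey.
rewrite e /mesh; move: (grid_coord k y i) => z.
set v := (y ord0 i - _) / _; set w := (x ord0 i - _) / _ => /andP[h1 h2] /andP[h3 h4].
have d8 : 0 < 8 * delta by rewrite mulr_gt0.
have p2 : 0 < 2 ^+ k :> R by rewrite exprn_gt0.
have -> : x ord0 i - y ord0 i = (8 * delta) / 2 ^+ k * (2 ^+ k * (w - v)).
  by rewrite /w /v; field; rewrite !gt_eqF.
rewrite normrM gtr0_norm ?divr_gt0 //; apply: ler_piMr; first by rewrite divr_ge0 ?ltW.
by rewrite ler_norml; apply/andP; split; lra.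
Qed.

Definition near_label (K : R) k x q :=
  `[< exists y, [/\ E y, label k y = q & `|y - x| <= K * mesh k] >].

(** Within two meshes each grid coordinate moves by at most 2, so the cells involved inject into [n]
    coordinates with five values each. *)
Lemma sum_near_label (F : nat -> R) (B : R) k x : E x -> 0 <= B ->
  (forall q, near_label 2 k x q -> F q <= B) ->
  \sum_(q < branching ^ k | near_label 2 k x q) F q <= (5 ^ n)%:R * B.
Proof.
move=> Ex B0 FB.
apply: (@le_trans _ _ (\sum_(q < branching ^ k | near_label 2 k x q) B)).
  by apply: ler_sum => q; exact: FB.
rewrite sumr_const -[leLHS]mulr_natl; apply: ler_wpM2r => //; rewrite ler_nat.
pose A := [set q : 'I_(branching ^ k) | near_label 2 k x q]%SET.
rewrite (_ : #|_| = #|A|); last by apply: eq_card => q; rewrite !finset.inE.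
have AP (q : 'I_(branching ^ k)) : q \in A ->
    exists y, [/\ E y, label k y = q & `|y - x| <= 2 * mesh k].
  by rewrite finset.inE => /asboolP.
pose rp (q : 'I_(branching ^ k)) : 'rV[R]_n :=
  if pselect (q \in A) is left h then sval (cid (AP q h)) else x.
have rpP q : q \in A -> [/\ E (rp q), label k (rp q) = q & `|rp q - x| <= 2 * mesh k].
  rewrite /rp; case: pselect => [h _|//]; exact: (svalP (cid (AP q h))).
(* The offset 2 makes the difference of the coordinates a natural number below 5. *)
pose code (q : 'I_(branching ^ k)) : {ffun 'I_n -> 'I_5} :=
  [ffun i => inord (grid_coord k (rp q) i + 2 - grid_coord k x i)].
have bnd q i : q \in A -> (grid_coord k x i <= grid_coord k (rp q) i + 2)%N /\
    (grid_coord k (rp q) i + 2 - grid_coord k x i < 5)%N.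
  move=> /rpP[Eq _ qx].
  have := coord_le_norm (rp q - x) i; rewrite !mxE => /le_trans /(_ qx).
  have := grid_coord_bounds k i Ex; have := grid_coord_bounds k i Eq.
  move: (grid_coord k x i) (grid_coord k (rp q) i) => a c.
  set v := (rp q ord0 i - _) / _; set w := (x ord0 i - _) / _ => /andP[h1 h2] /andP[h3 h4].
  have d8 : 0 < 8 * delta by rewrite mulr_gt0.
  have p2 : 0 < 2 ^+ k :> R by rewrite exprn_gt0.
  have -> : rp q ord0 i - x ord0 i = (8 * delta) / 2 ^+ k * (2 ^+ k * (v - w)).
    by rewrite /w /v; field; rewrite !gt_eqF.
  rewrite normrM gtr0_norm ?divr_gt0 // -/(mesh k) mulrC ler_pM2r ?mesh_gt0 //.
  rewrite ler_norml => /andP[h5 h6].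
  have ac : (a < c + 3)%N.
    by rewrite -(@ltr_nat R) natrD; lra.
  have ca : (c < a + 3)%N.
    by rewrite -(@ltr_nat R) natrD; lra.
  by split; lia.
rewrite -(card_in_imset (f := code)) => [|q1 q2 q1A q2A e].
  apply: (leq_trans (max_card _)); rewrite card_ffun !card_ord; exact: leqnn.
have [E1 l1 _] := rpP _ q1A; have [E2 l2 _] := rpP _ q2A.
apply: val_inj; rewrite /= -l1 -l2; apply/(eq_labelP k E1 E2) => i.
have [b1 c1] := bnd _ i q1A; have [b2 c2] := bnd _ i q2A.
move/ffunP/(_ i): e; rewrite !ffunE => /(congr1 val) /=.
by rewrite !inordK //; lia.
Qed.

End DyadicCells.

(** * Cell weights and their limit *)

Section CellWeights.
Context (R : realType) (n d : nat) (E : set 'rV[R]_n) (x0 : 'rV[R]_n) (delta : R).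
Hypothesis n_gt0 : (0 < n)%N.
Hypothesis d_gt0 : (0 < d)%N.
Hypothesis delta_gt0 : 0 < delta.
Hypothesis E_bounded : forall x, E x -> `|x - x0| <= delta.

Local Notation b := (branching n).
Local Notation label := (label x0 delta).
Local Notation mesh := (mesh delta).
Local Notation near_label := (near_label E x0 delta).

(** The first factor turns the covering radii of [heavy_cover] into Euclidean diameters,
    [heavy_const] is the fullness of the cells, and the exponential is the variation of [v] over
    [b + 4] meshes. *)
Definition cover_const : R :=
  (2 * n%:R * (b%:R + 2)) ^+ d / heavy_const R b * expR (b%:R + 4).

(* [M k q] is the mass of the cell number [q] of generation [k], and [v k x] is
   the normalised density at [x] at scale [mesh k]: the mass of the cells of
   generation [k] around [x] is comparable to [v k x * mesh k ^+ d]. *)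
Record cell_weights (N : nat) (M : nat -> nat -> R) (v : nat -> 'rV[R]_n -> R) : Prop :=
  CellWeights {
  cw_ge0 : forall k q, 0 <= M k q;
  cw_le : forall k q, M k q <= mesh 0 ^+ d;
  cw_empty : forall k q, (forall x, E x -> label k x <> q) -> M k q = 0;
  cw_split : forall k q, M k q = \sum_(a < b) M k.+1 (b * q + a)%N;
  cw_upper : forall k x, (k <= N)%N -> E x ->
    M k (label k x) <= expR 1 * v k x * mesh k ^+ d;
  cw_lower : forall k x (A : set 'rV[R]_n) h, (k <= N)%N -> E x -> A `<=` E ->
    (forall y, A y -> `|y - x| <= mesh k) -> (h%:E <= hausdorff_content d A)%E ->
    v k x * h <= cover_const * \sum_(q < b ^ k | near_label (b%:R + 4) k x q) M k q;
  cw_v0 : forall x, v 0%N x = 1;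
  cw_v_ge0 : forall k x, 0 <= v k x;
  cw_v_le1 : forall k x, v k x <= 1;
  cw_vS_le : forall k x, (k < N)%N -> v k.+1 x <= v k x;
  cw_vS_ge : forall k x, (k < N)%N -> v k x <= b%:R * v k.+1 x;
  cw_v_lip : forall k x y, (k <= N)%N -> v k x <= v k y * expR (`|x - y| / mesh k) }.

Lemma cover_const_gt0 : 0 < cover_const.
Proof.
rewrite mulr_gt0 ?expR_gt0 // divr_gt0 ?heavy_const_gt0 ?branching_gt0 //.
by rewrite exprn_gt0 // mulr_gt0 // ?mulr_gt0 ?ltr0n // ltr_wpDl.
Qed.

(** The finite stage is run with one sample point in each cell of generation [m] that meets [E]. *)
Lemma finite_cell_weights m : exists M v, cell_weights m M v.
Proof.
pose I := {i : 'I_(b ^ m) | `[< exists x, E x /\ label m x = i >]}.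
have pP (i : I) : exists x, E x /\ label m x = val i by exact: asboolW (valP i).
pose p (i : I) := sval (cid (pP i)).
have p_in i : E (p i) by case: (svalP (cid (pP i))).
have p_label i : label m (p i) = val i by case: (svalP (cid (pP i))).
pose D (x y : 'rV[R]_n) := `|x - y|.
(* Stages count upwards from the finest generation. Beyond stage [m] truncated subtraction stays at
   the root, whose label is 0. *)
pose l t x := label (m - t) x.
pose s0 := mesh m.
have D_refl x : D x x = 0 by rewrite /D subrr normr0.
have D_sym x y : D x y = D y x by rewrite /D distrC.
have D_triangle x y z : D x z <= D x y + D y z.
  by rewrite /D -(subrKA y); exact: ler_normD.
have b_gt0 := branching_gt0 n.
have s0_gt0 : 0 < s0 by exact: mesh_gt0.
have l_parent t x : l t.+1 x = (l t x %/ b)%N.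
  rewrite /l; case: (ltnP t m) => tm.
    by rewrite -(subnSK tm); exact: label_parent.
  by rewrite (eqP (tm : (m - t)%N == 0%N)) subnS (eqP (tm : (m - t)%N == 0%N)) /= div0n.
have scaleE t : (t <= m)%N -> scale s0 t = mesh (m - t).
  by move=> tm; rewrite /scale /s0 mulrC (meshD delta (m - t) t) subnK.
have l_diam t x y : E x -> E y -> l t x = l t y -> D x y <= s0 * 2 ^+ t.
  move=> Ex Ey e; have := label_diam delta_gt0 E_bounded Ex Ey e.
  rewrite -/(scale s0 t) /D => /le_trans; apply.
  case: (leqP t m) => tm; first by rewrite scaleE.
  rewrite (_ : m - t = m - m)%N; last by lia.
  by rewrite -scaleE //; apply: scale_le => //; exact: ltnW.
have p_inj i j : l 0%N (p i) = l 0%N (p j) -> i = j.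
  by rewrite /l subn0 !p_label => e; do 2!apply: val_inj.
have p_onto y : E y -> exists i, l 0%N (p i) = l 0%N y.
  move=> Ey; have h : `[< exists x, E x /\ label m x = Ordinal (label_lt x0 delta m y) >].
    by apply/asboolP; exists y.
  exists (exist _ (Ordinal (label_lt x0 delta m y)) h).
  by rewrite /l subn0 p_label.
pose W := weight D p l s0 d.
have W_gt0 t x : 0 < W t x by exact: (weight_gt0 (b := b)).
have W_ratio t T x y : (t <= T)%N ->
    W T x * W t y <= W T y * W t x * expR (D x y / scale s0 t).
  by move=> tT; exact: (weight_ratio (b := b)).
have W_mass t x : cell_mass p l s0 d (W t) t x <= scale s0 t ^+ d.
  exact: (cell_mass_weight (b := b)).
have W_le t u x : (t <= u)%N -> W u x <= W t x by exact: (weight_le (b := b)).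
have WS_ge t x : W t x <= b%:R * W t.+1 x by exact: weightS_ge.
pose F i := s0 ^+ d * W m (p i).
have F_ge0 i : 0 <= F i by rewrite mulr_ge0 ?exprn_ge0 // ltW.
pose M k q := \sum_(i | label k (p i) == q) F i.
(* The dampings up to the scale [mesh k] cancel; the coarser ones remain. *)
pose v k x := W m x / W (m - k)%N x.
have W_lip k x y : W m x / W (m - k)%N x <=
    W m y / W (m - k)%N y * expR (D x y / scale s0 (m - k)).
  set e := expR _; rewrite ler_pdivrMr //.
  have -> : W m y / W (m - k)%N y * e * W (m - k)%N x =
      W m y * W (m - k)%N x * e / W (m - k)%N y by ring.
  by rewrite ler_pdivlMr // W_ratio ?leq_subr.
exists M, v; split.
- by move=> k q; apply: sumr_ge0 => i _; exact: F_ge0.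
- move=> k q.
  have := W_mass m x0; rewrite scaleE // subnn /cell_mass /l subnn /=.
  rewrite (eq_bigl predT) // => h; apply: le_trans h.
  rewrite [leRHS](bigID (fun i => label k (p i) == q)) /= lerDl.
  by apply: sumr_ge0 => i _; exact: F_ge0.
- move=> k q hq; rewrite /M big1 // => i /eqP e.
  by case: (hq _ (p_in i)).
- move=> k q.
  rewrite /M (partition_big (fun i => digit x0 delta k.+1 (p i)) predT) //=.
  apply: eq_bigr => a _; apply: eq_bigl => i.
  apply/andP/eqP => [[/eqP <- /eqP <-]//|e].
  have e1 : label k (p i) = q.
    rewrite label_parent /= e mulnC divnMDl ?branching_gt0 // divn_small ?addn0 //.
  by split; apply/eqP => //; apply/val_inj/eqP; rewrite -(eqn_add2l (b * q)) -e e1.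
- move=> k x km Ex; set T := (m - k)%N.
  have Tk : (m - T)%N = k by rewrite subKn.
  have sT : scale s0 T = mesh k by rewrite scaleE ?leq_subr // Tk.
  have := W_mass T x; rewrite sT /cell_mass /l Tk => h.
  (* On one cell [v k] varies by a factor at most [e]. Taking it out leaves the mass before the
     coarser dampings, which [W_mass] bounds. *)
  apply: (@le_trans _ _ (expR 1 * v k x * \sum_(i | label k (p i) == label k x) s0 ^+ d * W T (p i))).
    rewrite mulr_sumr; apply: ler_sum => i /eqP e.
    rewrite mulrCA /F ler_pM2l ?exprn_gt0 //.
    rewrite -ler_pdivrMr // [leRHS]mulrC.
    apply: le_trans (W_lip k (p i) x) _; rewrite -/T sT.
    rewrite ler_pM2l ?divr_gt0 // ler_expR ler_pdivrMr ?mesh_gt0 // mul1r.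
    exact: (label_diam delta_gt0 E_bounded (p_in i) Ex e).
  by rewrite ler_wpM2l // mulr_ge0 ?expR_ge0 // divr_ge0 // ltW.
- move=> k x A h km Ex AE Ax hA; set T := (m - k)%N.
  have Tk : (m - T)%N = k by rewrite subKn.
  have sT : scale s0 T = mesh k by rewrite scaleE ?leq_subr // Tk.
  (* The covering is done at stage [T], before the dampings coarser than [mesh k]; multiplying by
     [v k x] then restores them. *)
  have [|S [g [cov sumS]]] := heavy_cover (D := D) d D_refl D_sym D_triangle b_gt0
    s0_gt0 l_parent l_diam p_inj p_in T AE.
    by move=> y /AE; exact: p_onto.
  have b2 : 0 < b%:R + 2 :> R by rewrite ltr_wpDl.
  have := content_finite_cover (rad := fun i => (b%:R + 2) * scale s0 (g i)) d_gt0 _ cov.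
  move=> /(_ (fun i => mulr_ge0 (ltW b2) (ltW (scale_gt0 s0_gt0 (g i))))).
  move=> /(le_trans hA); rewrite lee_fin.
  under eq_bigr do rewrite mulrA exprMn.
  rewrite -mulr_sumr => hS.
  have hc := heavy_const_gt0 R b_gt0.
  have c0 : 0 <= (2 * n%:R * (b%:R + 2)) ^+ d :> R by rewrite exprn_ge0 // mulr_ge0 // ltW.
  have v0 : 0 <= v k x by rewrite divr_ge0 // ltW.
  move: sumS; rewrite mulrC -ler_pdivlMr // => sumS.
  apply: (le_trans (ler_wpM2l v0 (le_trans hS (ler_wpM2l c0 sumS)))).
  rewrite /cover_const; set c := _ ^+ d; set hc' := heavy_const R b.
  set Snear := (X in v k x * (c * (X / hc'))); set Sq := (X in _ <= _ * X).
  have -> : v k x * (c * (Snear / hc')) = c / hc' * (v k x * Snear) by ring.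
  rewrite -[leRHS]mulrA; apply: ler_wpM2l; first by rewrite divr_ge0 // ltW.
  rewrite {}/Snear {}/Sq.
  (* [A] lies within one mesh of [x] and the sample points within [b + 3] of [A]. Replacing [v k x]
     by the value at such a point costs [expR (b + 4)]. *)
  apply: (@le_trans _ _ (expR (b%:R + 4) * \sum_(j | `|p j - x| <= (b%:R + 4) * mesh k) F j)).
    rewrite mulr_sumr mulr_sumr [leRHS]big_mkcond [leLHS]big_mkcond.
    apply: ler_sum => j _; case: ifPn => [|_]; last first.
      by case: ifP => // _; rewrite mulr_ge0 ?expR_ge0.
    move=> /asboolP[y Ay yj]; rewrite sT in yj.
    have px : D x (p j) <= (b%:R + 4) * mesh k.
      apply: le_trans (D_triangle _ y _) _; rewrite D_sym.
      by have := Ax _ Ay; move: yj; rewrite /D; lra.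
    rewrite -[`|_|]/(D (p j) x) D_sym px.
    rewrite mulrCA [leRHS]mulrCA /F ler_pM2l ?exprn_gt0 //.
    rewrite /v mulrAC ler_pdivrMr //.
    apply: le_trans (W_ratio T m x (p j) (leq_subr _ _)) _.
    rewrite mulrC -mulrA; apply: ler_wpM2r; first by rewrite mulr_ge0 // ltW.
    by rewrite ler_expR sT ler_pdivrMr ?mesh_gt0.
  apply: ler_wpM2l; first exact: expR_ge0.
  rewrite (partition_big (fun j => Ordinal (label_lt x0 delta k (p j)))
    (fun q : 'I_(b ^ k) => near_label (b%:R + 4) k x q)) /=; last first.
    by move=> j hj; apply/asboolP; exists (p j).
  apply: ler_sum => q _; rewrite /M [leLHS]big_mkcond [leRHS]big_mkcond.
  apply: ler_sum => j _.
  case: ifP => [/andP[_ /eqP <-]|_]; first by rewrite eqxx.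
  by case: ifP.
- by move=> x; rewrite /v subn0 divff // gt_eqF.
- by move=> k x; rewrite divr_ge0 // ltW.
- move=> k x; rewrite ler_pdivrMr // mul1r.
  exact/W_le/leq_subr.
- move=> k x km; rewrite ler_pM2l // lef_pV2 ?posrE //.
  by rewrite -(subnSK km) W_le.
- move=> k x km; rewrite /v ler_pdivrMr //.
  have -> : b%:R * (W m x / W (m - k.+1)%N x) * W (m - k)%N x =
      W m x * (b%:R * W (m - k)%N x) / W (m - k.+1)%N x by ring.
  rewrite ler_pdivlMr // ler_pM2l //.
  by rewrite -(subnSK km) WS_ge.
- move=> k x y km.
  by apply: le_trans (W_lip k x y) _; rewrite scaleE ?leq_subr // subKn.
Qed.

End CellWeights.

(** Compactness gives a cluster point. An ultrafilter converges to it, since otherwise it would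
    contain the complement of some neighbourhood. *)
Lemma ultra_bounded_cvg (R : realType) (U : set_system nat) (u : nat -> R) (a c : R) :
  UltraFilter U -> (forall m, a <= u m <= c) -> exists l : R, u @ U --> l.
Proof.
move=> UU uac.
have UP : ProperFilter U := ultra_proper.
have [l [_ cl]] : `[a, c]%classic `&` cluster (u @ U) !=set0.
  apply: segment_compact.
  by apply: (@filterE _ U) => m /=; rewrite in_itv /=; exact: uac.
exists l => A nA.
have [//|UA] := in_ultra_setVsetC (u @^-1` A) UU.
by have [y [nAy Ay]] := cl (~` A) A UA nA; case: nAy.
Qed.

Section LimitWeights.
Context (R : realType) (n d : nat) (E : set 'rV[R]_n) (x0 : 'rV[R]_n) (delta : R).
Hypothesis n_gt0 : (0 < n)%N.
Hypothesis d_gt0 : (0 < d)%N.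
Hypothesis delta_gt0 : 0 < delta.
Hypothesis E_bounded : forall x, E x -> `|x - x0| <= delta.

(** One ultrafilter gives all limits at once, including those of [v k x] for uncountably many [x].
    The conditions involve finite sums and non-strict inequalities and hold from some stage on, so
    they survive in the limit for every [N]. *)
Lemma exists_cell_weights : exists M v, forall N, cell_weights d E x0 delta N M v.
Proof.
have [U [UU ooU]] := @ultraFilterLemma nat \oo eventually_filter.
have UP : ProperFilter U := ultra_proper.
have fin m := finite_cell_weights n_gt0 d_gt0 delta_gt0 E_bounded m.
pose Mf m := sval (cid (fin m)); pose finM m := svalP (cid (fin m)).
pose vf m := sval (cid (finM m)).
have H m : cell_weights d E x0 delta m (Mf m) (vf m) := svalP (cid (finM m)).
have limM k q : exists l : R, (fun m => Mf m k q) @ U --> l.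
  apply: ultra_bounded_cvg => m; apply/andP; split; first exact: (cw_ge0 (H m)).
  exact: (cw_le (H m)).
have limv k x : exists l : R, (fun m => vf m k x) @ U --> l.
  apply: ultra_bounded_cvg => m; apply/andP; split; first exact: (cw_v_ge0 (H m)).
  exact: (cw_v_le1 (H m)).
pose M k q := sval (cid (limM k q)).
pose v k x := sval (cid (limv k x)).
have cM k q : (fun m => Mf m k q) @ U --> M k q := svalP (cid (limM k q)).
have cv k x : (fun m => vf m k x) @ U --> v k x := svalP (cid (limv k x)).
have cst (r : R) : (fun=> r) @ U --> r by exact: cvg_cst.
have sum_cvg (J : Type) (s : seq J) (P : pred J) (f : J -> nat -> R) (g : J -> R) :
    (forall j, f j @ U --> g j) ->
    (fun m => \sum_(j <- s | P j) f j m) @ U --> \sum_(j <- s | P j) g j.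
  by move=> fg; apply: (@cvg_big _ _ +%R) => //; exact: add_continuous.
have leU N (f g : nat -> R) (a c : R) : f @ U --> a -> g @ U --> c ->
    (forall m, (N <= m)%N -> f m <= g m) -> a <= c.
  move=> fa gc h; apply: (ler_cvg_to fa gc); apply: ooU.
  by exists N => // m /= Nm; exact: h.
have uniqU (f : nat -> R) (a c : R) : f @ U --> a -> f @ U --> c -> a = c.
  move=> fa fc; apply/eqP.
  by rewrite eq_le (leU 0%N f f a c) // (leU 0%N f f c a).
exists M, v => N; split.
- by move=> k q; apply: (leU 0%N _ _ _ _ (cst 0) (cM k q)) => m _; exact: (cw_ge0 (H m)).
- by move=> k q; apply: (leU 0%N _ _ _ _ (cM k q) (cst _)) => m _; exact: (cw_le (H m)).
- move=> k q hq; apply/eqP; rewrite eq_le; apply/andP; split.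
    apply: (leU 0%N _ _ _ _ (cM k q) (cst 0)) => m _.
    by rewrite (cw_empty (H m) hq).
  apply: (leU 0%N _ _ _ _ (cst 0) (cM k q)) => m _.
  by rewrite (cw_empty (H m) hq).
- move=> k q.
  apply: (uniqU _ _ _ (cM k q)).
  rewrite (_ : (fun m => Mf m k q) =
    (fun m => \sum_(a < branching n) Mf m k.+1 (branching n * q + a)%N)); last first.
    by apply/funext => m; exact: (cw_split (H m)).
  by apply: sum_cvg => j; exact: cM.
- move=> k x kN Ex.
  apply: (leU k _ _ _ _ (cM k _) (cvgM (cvgM (cst _) (cv k x)) (cst _))) => m km.
  exact: (cw_upper (H m)).
- move=> k x A h kN Ex AE Ax hA.
  have cs := sum_cvg _ (index_enum 'I_(branching n ^ k))
    (fun q => near_label E x0 delta ((branching n)%:R + 4) k x q)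
    (fun q m => Mf m k q) (fun q => M k q) (fun q => cM k q).
  apply: (leU k _ _ _ _ (cvgM (cv k x) (cst h)) (cvgM (cst _) cs)) => m km.
  exact: (cw_lower (H m) km Ex AE Ax hA).
- move=> x; apply: (uniqU _ _ _ (cv 0%N x)).
  rewrite (_ : (fun m => vf m 0%N x) = (fun=> 1)); first exact: cst.
  by apply/funext => m; exact: (cw_v0 (H m)).
- by move=> k x; apply: (leU 0%N _ _ _ _ (cst 0) (cv k x)) => m _; exact: (cw_v_ge0 (H m)).
- by move=> k x; apply: (leU 0%N _ _ _ _ (cv k x) (cst 1)) => m _; exact: (cw_v_le1 (H m)).
- by move=> k x kN; apply: (leU k.+1 _ _ _ _ (cv _ x) (cv _ x)) => m km; exact: (cw_vS_le (H m)).
- move=> k x kN; apply: (leU k.+1 _ _ _ _ (cv _ x) (cvgM (cst _) (cv _ x))) => m km.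
  exact: (cw_vS_ge (H m)).
- move=> k x y kN; apply: (leU k _ _ _ _ (cv _ x) (cvgM (cv _ y) (cst _))) => m km.
  exact: (cw_v_lip (H m)).
Qed.

End LimitWeights.

(** * The measure of a tree of masses *)

Section TreeMeasure.
Context (R : realType) (n : nat) (E : set 'rV[R]_n) (x0 : 'rV[R]_n) (delta : R).
Hypothesis delta_gt0 : 0 < delta.
Hypothesis E_bounded : forall x, E x -> `|x - x0| <= delta.
Hypothesis E_compact : compact E.
Hypothesis E_x0 : E x0.
Context (M : nat -> nat -> R).

Local Notation b := (branching n).
Local Notation label := (label x0 delta).
Local Notation mesh := (mesh delta).

Hypothesis M_ge0 : forall k q, 0 <= M k q.
Hypothesis M_empty : forall k q, (forall x, E x -> label k x <> q) -> M k q = 0.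
Hypothesis M_split : forall k q, M k q = \sum_(a < b) M k.+1 (b * q + a)%N.

Definition cum k i : R := \sum_(j < i) M k j.

Definition cell_itv k i : set R := `[cum k i, cum k i.+1[%classic.

Lemma cumSr k i : cum k i.+1 = cum k i + M k i.
Proof. by rewrite /cum big_ord_recr. Qed.

Lemma cum_le k i j : (i <= j)%N -> cum k i <= cum k j.
Proof.
move=> /subnK <-; elim: (j - i)%N => [//|m IH].
by rewrite addSn cumSr (le_trans IH) // lerDl.
Qed.

(** Children carry consecutive labels, so by [M_split] the partition points of one generation are
    among those of the next and the intervals are nested. *)
Lemma cum_child k i : cum k.+1 (b * i) = cum k i.
Proof.
elim: i => [|i IH]; first by rewrite muln0 /cum !big_ord0.
rewrite mulnSr cumSr -IH M_split /cum big_split_ord /=.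
by congr (_ + _).
Qed.

Lemma cum_total k : cum k (b ^ k) = M 0 0.
Proof.
elim: k => [|k IH]; first by rewrite expn0 /cum big_ord1.
by rewrite expnS cum_child.
Qed.

Lemma cell_itv_parent k j t : cell_itv k.+1 j t -> cell_itv k (j %/ b)%N t.
Proof.
rewrite /cell_itv /= !in_itv /= => /andP[h1 h2].
rewrite -(cum_child k (j %/ b)) -(cum_child k (j %/ b).+1); apply/andP; split.
  apply: le_trans h1; apply: cum_le; rewrite mulnC; exact: leq_trunc_div.
apply: (lt_le_trans h2); apply: cum_le.
by rewrite mulnC -ltn_divLR ?branching_gt0.
Qed.

Lemma cell_itv_inj k i j t : cell_itv k i t -> cell_itv k j t -> i = j.
Proof.
rewrite /cell_itv /= !in_itv /= => /andP[h1 h2] /andP[h3 h4].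
apply/eqP; rewrite eqn_leq; apply/andP; split; rewrite leqNgt; apply/negP => h.
  have := cum_le k h; lra.
have := cum_le k h; lra.
Qed.

Lemma cell_itv_exists k t : 0 <= t < M 0 0 ->
  exists i, (i < b ^ k)%N /\ cell_itv k i t.
Proof.
rewrite -(cum_total k) /cell_itv /= => /andP[t0].
elim: (b ^ k)%N => [|N IH] tN.
  by move: tN; rewrite /cum big_ord0; lra.
case: (ltP t (cum k N)) => [/IH [i [iN ti]]|h].
  by exists i; split => //; exact: leqW.
by exists N; split => //; rewrite in_itv /= h tN.
Qed.

(** A cell missing [E] has mass 0, so its half-open interval is empty. *)
Lemma cell_itv_point k t : 0 <= t < M 0 0 ->
  exists y, E y /\ cell_itv k (label k y) t.
Proof.
move=> /(cell_itv_exists k) [i [_ ti]].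
have [h|h] := pselect (exists y, E y /\ label k y = i).
  by have [y [Ey yi]] := h; exists y; split => //; rewrite yi.
have M0 : M k i = 0.
  by apply: M_empty => y Ey yi; apply: h; exists y.
by move: ti; rewrite /cell_itv /= in_itv /= cumSr M0 addr0 => /andP[]; lra.
Qed.

Lemma cell_itv_coarsen k m y t : (k <= m)%N ->
  cell_itv m (label m y) t -> cell_itv k (label k y) t.
Proof.
move=> /subnK <-; elim: (m - k)%N => [//|j IH].
by rewrite addSn => /cell_itv_parent; rewrite -label_parent.
Qed.

(** Cells are not closed, so a cluster point of points chosen in the nested cells of [t] may leave
    them; only the distance bound passes to the limit. *)
Lemma limit_point t : 0 <= t < M 0 0 ->
  exists y, E y /\ forall k x, E x -> cell_itv k (label k x) t -> `|y - x| <= mesh k.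
Proof.
move=> tM; pose pt k := sval (cid (cell_itv_point k tM)).
have Ept k : E (pt k) by case: (svalP (cid (cell_itv_point k tM))).
have tpt k : cell_itv k (label k (pt k)) t by case: (svalP (cid (cell_itv_point k tM))).
have [y [Ey cy]] : E `&` cluster (pt @ \oo) !=set0.
  apply: E_compact; by apply: (@filterE _ \oo) => m /=.
exists y; split => // k x Ex tx; apply/ler_addgt0Pl => e e0.
have A : (pt @ \oo) [set z | `|z - x| <= mesh k].
  exists k => // m /= km; apply: (label_diam delta_gt0 E_bounded (Ept m) Ex).
  exact: (cell_itv_inj (cell_itv_coarsen km (tpt m)) tx).
have [z [/= zx]] := cy _ _ A (nbhsx_ballx y e e0).
rewrite -ball_normE /= => yz.
apply: le_trans (ler_distD z y x) _; apply: lerD => //; exact: ltW.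
Qed.

Definition coding t : 'rV[R]_n :=
  if pselect (0 <= t < M 0 0) is left tM then sval (cid (limit_point tM)) else x0.

Lemma coding_in t : E (coding t).
Proof.
by rewrite /coding; case: pselect => // tM; case: (svalP (cid (limit_point tM))).
Qed.

Lemma coding_near t k x : 0 <= t < M 0 0 -> E x -> cell_itv k (label k x) t ->
  `|coding t - x| <= mesh k.
Proof.
rewrite /coding; case: pselect => // tM _ Ex tx.
by case: (svalP (cid (limit_point tM))) => _; exact.
Qed.

Lemma cell_itv_sub k i t : (i < b ^ k)%N -> cell_itv k i t -> 0 <= t < M 0 0.
Proof.
move=> ik; rewrite /cell_itv /= in_itv /= => /andP[h1 h2].
have := cum_le k ik; rewrite cum_total => h3; have := cum_le k (leq0n i).
rewrite {1}/cum big_ord0 => h4; apply/andP; split; lra.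
Qed.

Lemma cellsP k (S : pred nat) t :
  (\big[setU/set0]_(q < b ^ k | S q) cell_itv k q) t <->
  exists q, [/\ (q < b ^ k)%N, S q & cell_itv k q t].
Proof.
have := @bigcup_pred 'I_(b ^ k) R (fun q => S q) (fun q => cell_itv k q).
move=> <-; split=> [[q /= Sq tq]|[q [qk Sq tq]]].
  by exists q; split.
by exists (Ordinal qk).
Qed.

Lemma lebesgue_cells k (S : pred nat) :
  lebesgue_measure (\big[setU/set0]_(q < b ^ k | S q) cell_itv k q : set (measurableTypeR R))
   = (\sum_(q < b ^ k | S q) M k q)%:E.
Proof.
rewrite measure_bigsetU_ord_cond => [|q _|]; last 2 first.
- exact: measurable_itv.
- by move=> i j _ _ [t [ti tj]]; apply: val_inj; exact: cell_itv_inj ti tj.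
rewrite -sumEFin; apply: eq_bigr => q _.
apply: etrans (lebesgue_measure_itv `[cum k q, cum k q.+1[) _.
rewrite /= lte_fin cumSr.
case: ltP => [_|h]; first by rewrite -EFinB addrAC subrr add0r.
by congr EFin; apply/eqP; rewrite eq_le M_ge0 /=; lra.
Qed.

Lemma coding_measurable :
  measurable_fun [set: measurableTypeR R] (coding : measurableTypeR R -> borel_rV R n).
Proof.
apply: (@measurability _ _ (measurableTypeR R) (borel_rV R n) setT coding
  (@open 'rV[R]_n)) => // _ [U Uo <-].
rewrite setTI.
(* The preimage of [U] is the union of the intervals of cells whose points of [E] have their closed
   [mesh k]-ball inside [U], together with the parameters sent to the default [x0] when [U x0]. *)
pose good k q := `[< forall y, E y -> label k y = q ->
   forall z, `|z - y| <= mesh k -> U z >].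
pose D : set (measurableTypeR R) := `[0, M 0 0[%classic.
have mD : measurable D by exact: measurable_itv.
have -> : coding @^-1` U =
    (\bigcup_k \big[setU/set0]_(q < b ^ k | good k q) cell_itv k q) `|`
    (if pselect (U x0) is left _ then ~` D else set0) :> set (measurableTypeR R).
  apply/seteqP; split => t /=.
    move=> Ut; have [tD|tD] := pselect (0 <= t < M 0 0); last first.
      right; move: Ut; rewrite /coding; case: pselect => // _ Ux0.
      by case: pselect => // _; rewrite /D /= in_itv.
    left; have /nbhs_ballP[e /= e0 eU] : nbhs (coding t) U by exact: open_nbhs_nbhs.
    have e3 : 0 < e / 3 by rewrite divr_gt0.
    (* Three distances of at most one mesh add up: [coding t] to [y], [y] to [y'], [y'] to [z]. *)
    have [k ke] := mesh_small delta_gt0 e3.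
    exists k => //; have [y [Ey ty]] := cell_itv_point k tD.
    apply/cellsP; exists (label k y); split; rewrite ?label_lt //.
    apply/asboolP => y' Ey' e' z zy.
    apply: eU; rewrite -ball_normE /=.
    have h1 := coding_near tD Ey ty.
    have h2 := label_diam delta_gt0 E_bounded Ey Ey' (esym e').
    have h3 := ler_distD y (coding t) z.
    have h4 := ler_distD y' y z.
    have h5 : `|y' - z| <= mesh k by rewrite distrC.
    lra.
  case=> [[k _]|]; last first.
    case: pselect => // Ux0; rewrite /D /= in_itv /= => tD.
    by rewrite /coding; case: pselect.
  move=> /cellsP[q [qk /asboolP gq tq]].
  have tD := cell_itv_sub qk tq.
  have [y [Ey ty]] := cell_itv_point k tD.
  apply: (gq y Ey (cell_itv_inj ty tq)).
  exact: coding_near.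
apply: measurableU; last by case: pselect => _; [exact: measurableC|exact: measurable0].
apply: bigcupT_measurable => k; apply: bigsetU_measurable => q _.
exact: measurable_itv.
Qed.

(** A parameter in the interval of a cell is coded by a point within one mesh of that cell's points
    of [E], perhaps outside the cell. Both mass comparisons allow for this displacement. *)
Lemma exists_tree_measure : exists mu : {measure set (borel_rV R n) -> \bar R},
  [/\ mu (~` E) = 0%E, mu [set: borel_rV R n] = (M 0 0)%:E,
    forall k (S : pred nat) (A : set (borel_rV R n)), measurable A ->
      (forall y z, E y -> E z -> A z -> `|z - y| <= mesh k -> S (label k y)) ->
      (mu A <= (\sum_(q < b ^ k | S q) M k q)%:E)%E
  & forall k (S : pred nat) (A : set (borel_rV R n)), measurable A ->
      (forall y z, E y -> E z -> S (label k y) -> `|z - y| <= mesh k -> A z) ->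
      ((\sum_(q < b ^ k | S q) M k q)%:E <= mu A)%E].
Proof.
pose D : set (measurableTypeR R) := `[0, M 0 0[%classic.
have mD : measurable D by exact: measurable_itv.
pose leb : {measure set (measurableTypeR R) -> \bar R} := mrestr lebesgue_measure mD.
pose mu : {measure set (borel_rV R n) -> \bar R} :=
  @measure_function_pushforward__canonical__measure_function_Measure
    _ _ _ _ _ leb _ coding_measurable.
have muE A : mu A = lebesgue_measure (coding @^-1` A `&` D : set (measurableTypeR R)).
  by [].
have inD t : D t = (0 <= t < M 0 0) :> Prop by rewrite /D /= in_itv.
have mcells k (S : pred nat) :
    measurable (\big[setU/set0]_(q < b ^ k | S q) cell_itv k q : set (measurableTypeR R)).
  by apply: bigsetU_measurable => q _; exact: measurable_itv.
have mpre (A : set (borel_rV R n)) : measurable A ->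
    measurable (coding @^-1` A `&` D : set (measurableTypeR R)).
  by move=> mA; apply: measurableI => //; rewrite -[X in measurable X]setTI; exact: coding_measurable.
exists mu; split.
- rewrite muE (_ : _ `&` D = set0) ?measure0 //.
  by apply/seteqP; split => // t [/= /(_ (coding_in t))].
- rewrite muE preimage_setT setTI; apply: etrans (lebesgue_measure_itv `[0, M 0 0[) _.
  rewrite /= lte_fin.
  case: ltP => [_|h]; first by rewrite sube0.
  by congr EFin; apply/eqP; rewrite eq_le M_ge0 /=.
- move=> k S A mA h; rewrite muE -lebesgue_cells; apply: le_measure.
  + by rewrite inE; exact: mpre.
  + by rewrite inE; exact: mcells.
  move=> t [/= At]; rewrite inD => tD.
  have [y [Ey ty]] := cell_itv_point k tD.
  apply/cellsP; exists (label k y); split; rewrite ?label_lt //.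
  apply: (h y (coding t) Ey (coding_in t) At).
  exact: coding_near.
- move=> k S A mA h; rewrite muE -lebesgue_cells; apply: le_measure.
  + by rewrite inE; exact: mcells.
  + by rewrite inE; exact: mpre.
  move=> t /cellsP[q [qk Sq tq]].
  have tD := cell_itv_sub qk tq; split; last by rewrite inD.
  have [y [Ey ty]] := cell_itv_point k tD.
  apply: (h y (coding t) Ey (coding_in t)); last exact: coding_near.
  by rewrite (cell_itv_inj ty tq).
Qed.

End TreeMeasure.

(** * Estimates on balls *)

Lemma density_refine (R : realType) (B s vj vk m : R) (g d : nat) :
  0 < s -> 0 < m -> vk <= B ^+ g * vj ->
  s * vk * (2 ^+ g * m) ^+ d <= s * vj * m ^+ d * (B * 2 ^+ d) ^+ g.
Proof.
move=> s0 m0 h; rewrite !exprMn -[(2 ^+ d) ^+ g]exprM mulnC exprM.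
have T0 : 0 < (2 ^+ g) ^+ d :> R by rewrite !exprn_gt0.
have md : 0 < m ^+ d by rewrite exprn_gt0.
move: ((2 ^+ g) ^+ d) (m ^+ d) (B ^+ g) T0 md h => T m' B' T0 m'0 h.
have -> : s * vk * (T * m') = s * T * m' * vk by ring.
have -> : s * vj * m' * (B' * T) = s * T * m' * (B' * vj) by ring.
by rewrite ler_pM2l // !mulr_gt0.
Qed.

Section BallMeasure.
Context (R : realType) (n d : nat) (E : set 'rV[R]_n) (x0 : 'rV[R]_n) (delta : R).
Context (c1 : R).
Hypothesis n_gt0 : (0 < n)%N.
Hypothesis d_gt0 : (0 < d)%N.
Hypothesis c1_gt0 : 0 < c1.
Hypothesis delta_gt0 : 0 < delta.
Hypothesis E_bounded : forall x, E x -> `|x - x0| <= delta.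
Hypothesis E_compact : compact E.
Hypothesis E_x0 : E x0.
Hypothesis E_diam : eucl_diam E = delta%:E.
Hypothesis E_regular : lower_content_regular d c1 E.

Local Notation b := (branching n).
Local Notation mesh := (mesh delta).

(** There are at most [5 ^ n] neighbouring cells; [cw_upper] costs [e], and moving [v] over two
    meshes costs [e ^+ 2]. *)
Definition upper_const : R := (5 ^ n)%:R * expR 3.

(** Chosen so that [2 ^ scale_gap] exceeds [n * (b + 6)]: a neighbourhood of [b + 6] fine meshes
    then fits in a Euclidean ball of radius [mesh k]. *)
Definition scale_gap := (n * (b + 6))%N.

Definition lower_const : R :=
  c1 / (16 ^+ d * cover_const R n d) / (b%:R * 2 ^+ d) ^+ scale_gap.

Lemma upper_const_gt0 : 0 < upper_const.
Proof. by rewrite mulr_gt0 ?expR_gt0 // ltr0n expn_gt0. Qed.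

Lemma lower_const_gt0 : 0 < lower_const.
Proof.
rewrite divr_gt0 ?exprn_gt0 ?mulr_gt0 ?ltr0n ?branching_gt0 ?exprn_gt0 //.
by rewrite invr_gt0 mulr_gt0 ?exprn_gt0 // cover_const_gt0.
Qed.

Lemma le_content (A B : set 'rV[R]_n) : A `<=` B ->
  (hausdorff_content d A <= hausdorff_content d B)%E.
Proof.
move=> AB; apply: ereal_inf_le_tmp => _ [F /= BF <-].
by exists F => //=; exact: subset_trans AB BF.
Qed.

Lemma content_ball_ge k x : E x ->
  ((c1 * (mesh k / 16) ^+ d)%:E <=
   hausdorff_content d (E `&` eucl_ball x (mesh k / 16)))%E.
Proof.
move=> Ex; apply: E_regular => //; first by rewrite divr_gt0 ?mesh_gt0.
rewrite E_diam lte_fin; have := mesh_le delta_gt0 (leq0n k).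
by have := delta_gt0; rewrite mesh0; lra.
Qed.

Lemma content_fin : exists h, 0 < h /\ hausdorff_content d E = h%:E.
Proof.
have lo := le_trans (content_ball_ge 0 E_x0) (le_content (@subIsetl _ E _)).
have hi : (hausdorff_content d E <= (\sum_(i in [set: unit]%SET) (2 * n%:R * delta) ^+ d)%:E)%E.
  apply: (content_finite_cover (q := fun=> x0) (rad := fun=> delta)) => //.
    by move=> _; exact: ltW.
  by move=> y Ey; exists tt; rewrite ?finset.inE //; exact: E_bounded.
case: (hausdorff_content d E) lo hi => [h| |] //= lo hi.
exists h; split => //; rewrite lee_fin in lo; apply: lt_le_trans lo.
by rewrite mulr_gt0 // exprn_gt0 // divr_gt0 // mesh_gt0.
Qed.

(* The mass of every cell is rescaled by [sigma] so that the total becomes the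
   content of [E]; only its upper bound matters, it cancels elsewhere. *)
Lemma exists_ball_measure : exists (mu : {measure set (borel_rV R n) -> \bar R})
    (v : nat -> 'rV[R]_n -> R) (sigma : R),
  [/\ mu (~` E) = 0%E, mu [set: borel_rV R n] = hausdorff_content d E,
    0 < sigma <= cover_const R n d,
    [/\ forall k x, 0 < v k x <= 1,
      forall k x, v k.+1 x <= v k x <= b%:R * v k.+1 x
    & forall k x y, v k x <= v k y * expR (`|x - y| / mesh k)]
  & (forall k x r, E x -> r <= mesh k ->
      (mu (eucl_ball x r) <= (upper_const * (sigma * v k x * mesh k ^+ d))%:E)%E) /\
    (forall k x r, E x -> mesh k <= r ->
      ((lower_const * (sigma * v k x * mesh k ^+ d))%:E <= mu (eucl_ball x r))%E)].
Proof.
have [M [v H]] := exists_cell_weights n_gt0 d_gt0 delta_gt0 E_bounded.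
have [h [h0 hE]] := content_fin.
have C0 : 0 < cover_const R n d by exact: cover_const_gt0.
(* The lower bound at the root with [A = E], where [v] is 1. It makes the root mass positive and
   yields [sigma <= cover_const]. *)
have M00 : h <= cover_const R n d * M 0 0.
  have := cw_lower (H 0%N) (leqnn 0) E_x0 (@subset_refl _ E) _ _.
  move=> /(_ h); rewrite (cw_v0 (H 0%N)) mul1r hE lexx => /(_ _ isT) h1.
  apply: le_trans (h1 _) _.
    move=> y /E_bounded /le_trans; apply.
    by have := delta_gt0; rewrite mesh0; lra.
  rewrite ler_pM2l // expn0 big_mkcond big_ord1 /=.
  by case: ifP => // _; exact: (cw_ge0 (H 0%N)).
have M0 : 0 < M 0 0.
  by move: (lt_le_trans h0 M00); rewrite pmulr_rgt0.
pose sigma := h / M 0 0.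
have s0 : 0 < sigma by exact: divr_gt0.
have sC : sigma <= cover_const R n d by rewrite ler_pdivrMr.
have sM : sigma * M 0 0 = h by rewrite /sigma divfK // gt_eqF.
clearbody sigma.
pose M' k q := sigma * M k q.
have M'_ge0 k q : 0 <= M' k q by rewrite mulr_ge0 ?(cw_ge0 (H 0%N)) // ltW.
have M'_empty k q : (forall x, E x -> label x0 delta k x <> q) -> M' k q = 0.
  by move=> hq; rewrite /M' (cw_empty (H 0%N) hq) mulr0.
have M'_split k q : M' k q = \sum_(a < b) M' k.+1 (b * q + a)%N.
  by rewrite /M' -mulr_sumr (cw_split (H 0%N)).
have [mu [muE muT mu_up mu_lo]] :=
  exists_tree_measure delta_gt0 E_bounded E_compact E_x0 M'_ge0 M'_empty M'_split.
have b0 : 0 < b%:R :> R by rewrite ltr0n branching_gt0.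
have vS k x : v k.+1 x <= v k x <= b%:R * v k.+1 x.
  by rewrite (cw_vS_le (H k.+1)) // (cw_vS_ge (H k.+1)).
have v0 k x : 0 < v k x <= 1.
  rewrite (cw_v_le1 (H k)) andbT.
  elim: k => [|k IH]; first by rewrite (cw_v0 (H 0%N)).
  have /andP[_ h2] := vS k x.
  by have := lt_le_trans IH h2; rewrite pmulr_rgt0.
have vlip k x y : v k x <= v k y * expR (`|x - y| / mesh k) by exact: (cw_v_lip (H k)).
have vgt k x : 0 < v k x by case/andP: (v0 k x).
have mball x (r : R) : measurable (eucl_ball x r : set (borel_rV R n)).
  by apply: sub_sigma_algebra; exact: eucl_ball_open.
exists mu, v, sigma; split => //.
- by rewrite muT hE /M' sM.
- by rewrite s0.
split=> [k x r Ex rk|k x r Ex kr].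
  apply: le_trans (mu_up k (near_label E x0 delta 2 k x) _ (mball x r) _) _.
    move=> y z Ey Ez zr zy; apply/asboolP; exists y; split => //.
    have h1 : `|x - z| <= r by apply: le_trans (norm_le_eucl x z) _; exact: ltW.
    have h2 := ler_distD z y x.
    have h3 : `|y - z| <= mesh k by rewrite distrC.
    have h4 : `|z - x| <= r by rewrite distrC.
    lra.
  rewrite lee_fin /upper_const -mulrA.
  apply: (sum_near_label delta_gt0 E_bounded Ex).
    by rewrite ltW // !mulr_gt0 ?expR_gt0 // exprn_gt0 // mesh_gt0.
  move=> q /asboolP[y [Ey <- yx]].
  have h1 := cw_upper (H k) (leqnn k) Ey.
  have h2 := vlip k y x.
  have h3 : expR (`|y - x| / mesh k) <= expR 2.
    by rewrite ler_expR ler_pdivrMr // mesh_gt0.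
  have h4 : v k y <= v k x * expR 2.
    by apply: (le_trans h2); rewrite ler_pM2l.
  have -> : expR 3 = expR 1 * expR 2 :> R.
    by rewrite -expRD; congr expR; rewrite -natrD.
  apply: (le_trans (ler_wpM2l (ltW s0) h1)).
  have -> : expR 1 * expR 2 * (sigma * v k x * mesh k ^+ d) =
    sigma * (expR 1 * (v k x * expR 2) * mesh k ^+ d) by ring.
  rewrite ler_pM2l // ler_pM2r ?exprn_gt0 ?mesh_gt0 //.
  by rewrite ler_pM2l ?expR_gt0.
(* The lower bound is read at a finer generation, where all cells supplied by [cw_lower] and the
   displacement of coded points fit in the ball. *)
set j := (k + scale_gap)%N.
have jk : n%:R * (b%:R + 6) * mesh j < r.
  apply: lt_le_trans kr; rewrite (meshD delta k scale_gap) -/j.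
  rewrite ltr_pM2r ?mesh_gt0 // -natrD -natrM -natrX ltr_nat.
  exact: ltn_expl.
have key : v j x * (c1 * (mesh j / 16) ^+ d) <= cover_const R n d *
    \sum_(q < b ^ j | near_label E x0 delta (b%:R + 4) j x q) M j q.
  apply: (cw_lower (H j) (leqnn j) Ex (@subIsetl _ E (eucl_ball x (mesh j / 16)))).
    move=> y [_ /= yx]; rewrite distrC; apply: le_trans (norm_le_eucl x y) _.
    by apply: le_trans (ltW yx) _; have := mesh_gt0 delta_gt0 j; lra.
  exact: content_ball_ge.
apply: le_trans (mu_lo j (near_label E x0 delta (b%:R + 4) j x) _ (mball x r) _); last first.
  move=> y z Ey Ez /asboolP[y' [Ey' yy' yx]] zy; rewrite /eucl_ball /=.
  apply: le_lt_trans jk; apply: le_trans (eucl_le_norm x z) _.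
  rewrite -mulrA; apply: ler_wpM2l => //.
  (* [b + 6] is [b + 4] from [near_label], one mesh for the cell and one for the displacement. *)
  have h1 := label_diam delta_gt0 E_bounded Ey' Ey yy'.
  have h2 := ler_distD y' z x.
  have h3 := ler_distD y z y'.
  have h4 : `|y - y'| <= mesh j by rewrite distrC.
  rewrite distrC; lra.
rewrite lee_fin /M' -mulr_sumr.
have vkj : v k x <= b%:R ^+ scale_gap * v j x.
  rewrite /j; elim: scale_gap => [|g IH]; first by rewrite expr0 mul1r addn0.
  apply: (le_trans IH); rewrite exprSr -mulrA ler_pM2l ?exprn_gt0 // addnS.
  by case/andP: (vS (k + g)%N x).
apply: (@le_trans _ _ (sigma * (v j x * (c1 * (mesh j / 16) ^+ d)) / cover_const R n d)).
  have -> : sigma * (v j x * (c1 * (mesh j / 16) ^+ d)) / cover_const R n d =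
      c1 / (16 ^+ d * cover_const R n d) * (sigma * v j x * mesh j ^+ d).
    by rewrite expr_div_n; field; rewrite !gt_eqF ?exprn_gt0.
  rewrite /lower_const -mulrA; apply: ler_wpM2l.
    by apply: ltW; rewrite divr_gt0 // mulr_gt0 // exprn_gt0.
  rewrite [leLHS]mulrC ler_pdivrMr ?exprn_gt0 ?mulr_gt0 ?exprn_gt0 //.
  rewrite (meshD delta k scale_gap) -/j.
  apply: density_refine => //; exact: mesh_gt0.
by rewrite -mulrA; apply: ler_wpM2l; [exact: ltW|rewrite ler_pdivrMr // [leRHS]mulrC].
Qed.

End BallMeasure.

Lemma unit_cube_eucl_dist (R : realType) (n : nat) (x y : 'rV[R]_n) :
  unit_cube R n x -> unit_cube R n y -> eucl_dist x y <= n%:R.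
Proof.
move=> hx hy; apply: (le_trans (eucl_le_norm x y)).
rewrite -[leRHS]mulr1; apply: ler_wpM2l => //; apply: norm_le_coord => // i.
rewrite !mxE ler_norml; have /andP[h1 h2] := hx i; have /andP[h3 h4] := hy i.
by apply/andP; split; lra.
Qed.

Lemma cd_rho_gt0 (R : realType) : 0 < cd_rho R.
Proof. by rewrite /cd_rho div1r invr_gt0 ltr0n. Qed.

Lemma cd_ell_gt0 (R : realType) (k : int) : 0 < cd_ell R k.
Proof. by rewrite /cd_ell pmulr_rgt0 ?ltr0n // exprz_gt0 // cd_rho_gt0. Qed.

(** * The five properties deduced from the ball estimates *)

Section BallEstimates.
Context (R : realType) (n d : nat) (E : set 'rV[R]_n) (delta : R).
Context (mu : {measure set (borel_rV R n) -> \bar R}).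
Context (v : nat -> 'rV[R]_n -> R) (B sigma s1 cu cl : R).
Local Notation mesh := (mesh delta).
Hypothesis delta_gt0 : 0 < delta.
Hypothesis B_gt0 : 0 < B.
Hypothesis sigma_gt0 : 0 < sigma.
Hypothesis sigma_le : sigma <= s1.
Hypothesis cu_gt0 : 0 < cu.
Hypothesis cl_gt0 : 0 < cl.
Hypothesis v01 : forall k x, 0 < v k x <= 1.
Hypothesis vS : forall k x, v k.+1 x <= v k x <= B * v k.+1 x.
Hypothesis v_lip : forall k x y, v k x <= v k y * expR (`|x - y| / mesh k).
Hypothesis mu_up : forall k x (r : R), E x -> r <= mesh k ->
  (mu (eucl_ball x r) <= (cu * (sigma * v k x * mesh k ^+ d))%:E)%E.
Hypothesis mu_lo : forall k x (r : R), E x -> mesh k <= r ->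
  ((cl * (sigma * v k x * mesh k ^+ d))%:E <= mu (eucl_ball x r))%E.
Hypothesis mu_compl : mu (~` E) = 0%E.
Hypothesis E_closed : closed E.

Lemma borel_open (A : set 'rV[R]_n) : open A -> measurable (A : set (borel_rV R n)).
Proof. by move=> Ao; apply: sub_sigma_algebra. Qed.

Lemma borel_closed (A : set 'rV[R]_n) : closed A -> measurable (A : set (borel_rV R n)).
Proof.
move=> Ac; rewrite -[A]setCK; apply: measurableC.
exact: borel_open (closed_openC Ac).
Qed.

Lemma borel_ball (x : 'rV[R]_n) (r : R) : measurable (eucl_ball x r : set (borel_rV R n)).
Proof. by apply: sub_sigma_algebra; exact: eucl_ball_open. Qed.

Lemma v_gt0 k x : 0 < v k x. Proof. by case/andP: (v01 k x). Qed.

Lemma v_anti k m x : (k <= m)%N -> v m x <= v k x.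
Proof.
move=> /subnK <-; elim: (m - k)%N => [//|j IH].
by rewrite addSn; apply: le_trans IH; case/andP: (vS (j + k)%N x).
Qed.

Lemma v_slow k j x : v k x <= B ^+ j * v (k + j)%N x.
Proof.
elim: j => [|j IH]; first by rewrite expr0 mul1r addn0.
apply: (le_trans IH); rewrite exprSr -mulrA ler_pM2l ?exprn_gt0 // addnS.
by case/andP: (vS (k + j)%N x).
Qed.

Lemma support_eq : msupport mu = E.
Proof.
apply/seteqP; split => x /=.
  move=> sx; apply: contrapT => nEx.
  have := sx (~` E) (closed_openC E_closed) nEx.
  by rewrite mu_compl ltxx.
move=> Ex U Uo Ux.
have /nbhs_ballP[e /= e0 eU] : nbhs x U by exact: open_nbhs_nbhs.
have [k ke] := mesh_small delta_gt0 e0.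
apply: (@lt_le_trans _ _ (mu (eucl_ball x e))).
  apply: lt_le_trans (mu_lo Ex (ltW ke)).
  by rewrite lte_fin !mulr_gt0 ?exprn_gt0 ?mesh_gt0 ?v_gt0.
apply: le_measure; rewrite ?inE; [exact: borel_ball|exact: borel_open|].
move=> y /= xy; apply: eU; rewrite -ball_normE /=.
exact: le_lt_trans (norm_le_eucl x y) xy.
Qed.

(** Only [v <= 1] and the upper bound on [sigma] enter, so the constant does not involve the
    regularity constant; [2 ^+ d] comes from [mesh k < 2 * r]. *)
Lemma ball_growth (x : 'rV[R]_n) (r : R) : E x -> 0 < r -> r < delta ->
  (mu (eucl_ball x r) <= ((1 + cu * s1 * 2 ^+ d) * r ^+ d)%:E)%E.
Proof.
move=> Ex r0 rd; have d0 := delta_gt0.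
have [|k /andP[kr rk]] := mesh_bracket delta_gt0 r0.
  by rewrite mesh0; lra.
apply: (le_trans (mu_up Ex rk)); rewrite lee_fin.
apply: (@le_trans _ _ (cu * s1 * 2 ^+ d * r ^+ d)); last first.
  by rewrite mulrDl mul1r lerDr exprn_ge0 // ltW.
rewrite -!mulrA ler_pM2l // -exprMn; apply: ler_pM.
- exact: ltW.
- by rewrite ltW // mulr_gt0 ?v_gt0 // exprn_gt0 // mesh_gt0.
- exact: sigma_le.
rewrite -[leRHS]mul1r; apply: ler_pM.
- by rewrite ltW ?v_gt0.
- by rewrite ltW // exprn_gt0 // mesh_gt0.
- by case/andP: (v01 k x).
apply: lerXn2r; rewrite ?nnegrE ?ltW ?mesh_gt0 ?mulr_gt0 // meshS ltr_pM2l //.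
Qed.

Lemma ball_doubling (x : 'rV[R]_n) (r : R) : E x -> 0 < r -> r < delta ->
  (mu (eucl_ball x (2 * r)) <=
    (1 + cu * B ^+ 2 * 4 ^+ d / cl)%:E * mu (eucl_ball x r))%E.
Proof.
move=> Ex r0 rd; have d0 := delta_gt0.
have [|k /andP[kr rk]] := mesh_bracket delta_gt0 r0.
  by rewrite mesh0; lra.
case: k kr rk => [|j] jr rj.
  (* Generation 0 would force [r] above [mesh 1 = 4 * delta]. *)
  by exfalso; have e := meshS delta 0; rewrite mesh0 in e; lra.
have r2 : 2 * r <= mesh j by rewrite meshS; lra.
apply: (le_trans (mu_up Ex r2)).
have m0 : 0 < mesh j.+2 ^+ d by rewrite exprn_gt0 // mesh_gt0.
apply: (@le_trans _ _ ((cu * B ^+ 2 * 4 ^+ d / cl)%:E * mu (eucl_ball x r))%E); last first.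
  apply: lee_wpmul2r; first exact: measure_ge0.
  by rewrite lee_fin lerDr.
apply: le_trans (lee_wpmul2l _ (mu_lo Ex (ltW jr))); last first.
  by rewrite lee_fin ltW // divr_gt0 // !mulr_gt0 // exprn_gt0.
rewrite -EFinM lee_fin.
have -> : mesh j = 4 * mesh j.+2 by rewrite (meshS delta j) (meshS delta j.+1); ring.
have h := v_slow j 2 x; rewrite addn2 in h.
have -> : cu * B ^+ 2 * 4 ^+ d / cl * (cl * (sigma * v j.+2 x * mesh j.+2 ^+ d)) =
    cu * (sigma * (B ^+ 2 * v j.+2 x) * (4 * mesh j.+2) ^+ d).
  rewrite [(4 * _) ^+ d]exprMn; move: (4 ^+ d) (mesh j.+2 ^+ d) => p4 pm.
  by field; rewrite gt_eqF.
rewrite ler_pM2l // ler_pM2r; last by rewrite exprn_gt0 // mulr_gt0 // mesh_gt0.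
by rewrite ler_pM2l.
Qed.

Lemma mesh_bracket_mono (r s : R) k m : r <= s -> mesh m.+1 < s -> r <= mesh k ->
  mesh k.+1 < r -> s <= mesh m -> (m <= k)%N.
Proof.
move=> rs ms rk kr sm; rewrite leqNgt; apply/negP => km.
by have := mesh_le delta_gt0 km; lra.
Qed.

(** The densities compare with [sigma * v] at the scales of the cubes, and [v k1 xP <= v k2 xP <= e
    * v k2 xQ <= e * B ^+ 10 * v (k2 + 10) xQ]: monotonicity, closeness of the centres, slow
    variation. *)
Lemma density_monotone (j k : int) (P Q : set 'rV[R]_n) (xP xQ : 'rV[R]_n) :
  E xP -> E xQ -> P `<=` eucl_ball xP (cd_ell R j) -> P xP ->
  eucl_ball xQ (cd_c0 R * cd_ell R k) `&` E `<=` Q ->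
  Q `<=` eucl_ball xQ (cd_ell R k) -> P `<=` Q -> cd_ell R k <= 5 * delta ->
  (cube_density d mu j P <=
   (1 + cu * 2 ^+ d * expR 1 * B ^+ 10 * (2 ^+ 10) ^+ d / cl)%:E * cube_density d mu k Q)%E.
Proof.
move=> ExP ExQ PxP PP QxQ QQ PQ kd; have d0 := delta_gt0.
set A := 1 + _.
have A1 : 1 <= A.
  by rewrite lerDl ltW // divr_gt0 // !mulr_gt0 ?expR_gt0 // !exprn_gt0.
have lj := cd_ell_gt0 R j; have lk := cd_ell_gt0 R k.
have ljd : 0 < cd_ell R j ^+ d by rewrite exprn_gt0.
have lkd : 0 < cd_ell R k ^+ d by rewrite exprn_gt0.
have muQ0 : (0 <= mu_ext mu Q)%E by apply: mu_ext_ge0.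
have muP0 : (0 <= mu_ext mu P)%E by apply: mu_ext_ge0.
have PQmu : (mu_ext mu P <= mu_ext mu Q)%E by exact: le_mu_ext.
have p1024 : 0 < (2 ^+ 10) ^+ d :> R by rewrite !exprn_gt0.
rewrite /cube_density !inver !gt_eqF //.
(* Inclusion of sets does not order the generations. If [P] has the larger side, monotonicity of the
   outer measure suffices. *)
have [jk|kj] := leP (cd_ell R j) (cd_ell R k); last first.
  apply: (@le_trans _ _ (mu_ext mu Q * ((cd_ell R k ^+ d)^-1)%:E)%E).
    apply: lee_pmul => //; rewrite lee_fin ?invr_ge0; first exact: ltW.
    rewrite lef_pV2 ?posrE //; apply: lerXn2r; rewrite ?nnegrE; exact: ltW.
  rewrite -[leLHS]mul1e; apply: lee_wpmul2r; last by rewrite lee_fin.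
  by apply: mule_ge0 => //; rewrite lee_fin invr_ge0 ltW.
have [|k1 /andP[k1j jk1]] := mesh_bracket delta_gt0 lj.
  by rewrite mesh0; lra.
have [|k2 /andP[k2k kk2]] := mesh_bracket delta_gt0 lk.
  by rewrite mesh0; lra.
have k21 : (k2 <= k1)%N by exact: (mesh_bracket_mono jk k2k jk1 k1j kk2).
have muP : (mu_ext mu P <= (cu * (sigma * v k1 xP * mesh k1 ^+ d))%:E)%E.
  apply: le_trans (mu_up ExP jk1).
  rewrite -(measurable_mu_extE mu (borel_ball xP (cd_ell R j))).
  exact: le_mu_ext.
have muQ : ((cl * (sigma * v (k2 + 10)%N xQ * mesh (k2 + 10) ^+ d))%:E <= mu_ext mu Q)%E.
  (* Ten generations: [mesh (k2 + 10)] is [mesh k2.+1 / 512], below the [1 / 500] of [cd_c0] times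
     the side. *)
  have h : mesh (k2 + 10) <= cd_c0 R * cd_ell R k.
    have e1 := meshD delta k2.+1 9; have e2 := mesh_gt0 delta_gt0 (k2 + 10).
    rewrite addSnnS in e1; have e3 : (2 : R) ^+ 9 = 512 by ring.
    rewrite e3 in e1; rewrite /cd_c0; lra.
  apply: (le_trans (mu_lo ExQ h)).
  have mBE : measurable (eucl_ball xQ (cd_c0 R * cd_ell R k) `&` E : set (borel_rV R n)).
    by apply: measurableI; [exact: borel_ball|exact: borel_closed].
  apply: (@le_trans _ _ (mu (eucl_ball xQ (cd_c0 R * cd_ell R k) `&` E))); last first.
    rewrite -(measurable_mu_extE mu mBE); exact: le_mu_ext.
  have mCE : measurable (~` E : set (borel_rV R n)).
    exact: borel_open (closed_openC E_closed).
  (* The complement of [E] is null, so intersecting the ball with [E] loses no mass. *)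
  rewrite -[leRHS]adde0 -mu_compl.
  apply: le_trans (measureU2 mu mBE mCE); apply: le_measure; rewrite ?inE.
  - exact: borel_ball.
  - exact: measurableU.
  by move=> y yB; have [Ey|nEy] := pselect (E y); [left|right].
apply: (@le_trans _ _ (cu * 2 ^+ d * (sigma * v k1 xP))%:E).
  rewrite lee_pdivrMr //.
  apply: (le_trans muP); rewrite -EFinM lee_fin.
  have -> : cu * 2 ^+ d * (sigma * v k1 xP) * cd_ell R j ^+ d =
      cu * (sigma * v k1 xP * (2 * cd_ell R j) ^+ d).
    by rewrite [(2 * _) ^+ d]exprMn; move: (2 ^+ d) (cd_ell R j ^+ d) => p2 pe; ring.
  rewrite ler_pM2l // ler_pM2l; last by rewrite mulr_gt0 ?v_gt0.
  by apply: lerXn2r; rewrite ?nnegrE ?(meshS delta k1); have := mesh_gt0 delta_gt0 k1.+1; lra.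
apply: (@le_trans _ _ (A%:E * (cl / (2 ^+ 10) ^+ d * (sigma * v (k2 + 10)%N xQ))%:E)%E); last first.
  apply: lee_wpmul2l; first by rewrite lee_fin; lra.
  rewrite lee_pdivlMr //.
  apply: le_trans muQ; rewrite -EFinM lee_fin.
  have -> : cl / (2 ^+ 10) ^+ d * (sigma * v (k2 + 10)%N xQ) * cd_ell R k ^+ d =
      cl * (sigma * v (k2 + 10)%N xQ * (cd_ell R k / 2 ^+ 10) ^+ d).
    rewrite [(_ / _) ^+ d]expr_div_n; move: ((2 ^+ 10) ^+ d) (cd_ell R k ^+ d) p1024 => p pe p0.
    by field; rewrite gt_eqF.
  rewrite ler_pM2l // ler_pM2l; last by rewrite mulr_gt0 ?v_gt0.
  have p10 : 0 < 2 ^+ 10 :> R by rewrite exprn_gt0.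
  apply: lerXn2r; rewrite ?nnegrE; first by rewrite divr_ge0 // ltW.
    by rewrite ltW // mesh_gt0.
  by rewrite ler_pdivrMr // mulrC -meshD.
rewrite -EFinM lee_fin.
apply: (@le_trans _ _ (cu * 2 ^+ d * expR 1 * B ^+ 10 * (2 ^+ 10) ^+ d / cl *
    (cl / (2 ^+ 10) ^+ d * (sigma * v (k2 + 10)%N xQ)))); last first.
  apply: ler_wpM2r; last by rewrite /A lerDr.
  by rewrite ltW // mulr_gt0 ?divr_gt0 ?exprn_gt0 // mulr_gt0 ?v_gt0.
have -> : cu * 2 ^+ d * expR 1 * B ^+ 10 * (2 ^+ 10) ^+ d / cl *
    (cl / (2 ^+ 10) ^+ d * (sigma * v (k2 + 10)%N xQ)) =
    cu * 2 ^+ d * (sigma * (B ^+ 10 * v (k2 + 10)%N xQ * expR 1)).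
  move: ((2 ^+ 10) ^+ d) (2 ^+ d) p1024 => p p2 p0.
  by field; rewrite !gt_eqF.
rewrite ler_pM2l ?mulr_gt0 ?exprn_gt0 // ler_pM2l //.
apply: (le_trans (v_anti xP k21)); apply: (le_trans (v_lip k2 xP xQ)).
apply: ler_pM.
- by rewrite ltW ?v_gt0.
- exact: expR_ge0.
- exact: v_slow.
rewrite ler_expR ler_pdivrMr ?mesh_gt0 // mul1r distrC.
apply: (le_trans (norm_le_eucl _ _)); apply: le_trans kk2.
by apply: ltW; apply: QQ; exact: PQ.
Qed.

End BallEstimates.

(** * Choice of the constants and assembly *)

Theorem theoremA1 (R : realType) (n d : nat) (d_gt0 : (1 <= d)%N)
    (d_le_n : (d <= n)%N) :
  exists C1 : R, 1 <= C1 /\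
  forall c1 : R, 0 < c1 ->
  exists Cdb A : R, 1 <= Cdb /\ 1 <= A /\
  forall (E : set 'rV[R]_n) (D : int -> set (set 'rV[R]_n)),
    compact E -> E `<=` unit_cube R n ->
    lower_content_regular d c1 E -> (0 < eucl_diam E)%E ->
    christ_david_cubes E D ->
  exists mu : {measure set (borel_rV R n) -> \bar R},
    [/\ msupport mu = E,
        mu E = hausdorff_content d E,
        forall (x : 'rV[R]_n) (r : R), E x -> 0 < r -> (r%:E < eucl_diam E)%E ->
          (mu (eucl_ball x r) <= (C1 * r ^+ d)%:E)%E,
        forall (x : 'rV[R]_n) (r : R), E x -> 0 < r -> (r%:E < eucl_diam E)%E ->
          (mu (eucl_ball x (2 * r)) <= Cdb%:E * mu (eucl_ball x r))%E
      & forall (j k : int) (P Q : set 'rV[R]_n), D j P -> D k Q ->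
          P `<=` Q -> ((cd_ell R k)%:E <= 5%:R%:E * eucl_diam E)%E ->
          (cube_density d mu j P <= A%:E * cube_density d mu k Q)%E].
Proof.
have n_gt0 : (0 < n)%N by exact: leq_trans d_le_n.
have cu0 := upper_const_gt0 R n.
have s0 : 0 < cover_const R n d by exact: cover_const_gt0.
pose B : R := (branching n)%:R.
have B0 : 0 < B by rewrite ltr0n branching_gt0.
exists (1 + upper_const R n * cover_const R n d * 2 ^+ d); split.
  rewrite lerDl ltW //; apply: mulr_gt0; last exact: exprn_gt0.
  exact: mulr_gt0.
move=> c1 c10; have cl0 : 0 < lower_const n d c1 by exact: lower_const_gt0.
exists (1 + upper_const R n * B ^+ 2 * 4 ^+ d / lower_const n d c1).
exists (1 + upper_const R n * 2 ^+ d * expR 1 * B ^+ 10 * (2 ^+ 10) ^+ d / lower_const n d c1).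
split.
  rewrite lerDl ltW //; apply: divr_gt0 => //; apply: mulr_gt0; last exact: exprn_gt0.
  by apply: mulr_gt0 => //; exact: exprn_gt0.
split.
  rewrite lerDl ltW //; apply: divr_gt0 => //; apply: mulr_gt0.
    apply: mulr_gt0; last exact: exprn_gt0.
    apply: mulr_gt0; last exact: expR_gt0.
    by apply: mulr_gt0 => //; exact: exprn_gt0.
  by do 2!apply: exprn_gt0.
move=> E D Ec Eu Ereg Ediam [Dpart _ Dball].
have [x0 Ex0] : E !=set0.
  by apply/set0P/eqP => E0; move: Ediam; rewrite E0 eucl_diam0 ltxx.
have [delta diamE] : exists delta, eucl_diam E = delta%:E.
  have : (eucl_diam E <= n%:R%:E)%E.
    by apply: eucl_diam_le => // x y /Eu hx /Eu hy; exact: unit_cube_eucl_dist.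
  by case: (eucl_diam E) Ediam => [r| |] // _ _; exists r.
have delta0 : 0 < delta by move: Ediam; rewrite diamE lte_fin.
have Ebd x : E x -> `|x - x0| <= delta.
  move=> Ex; apply: (le_trans (norm_le_eucl x x0)).
  by rewrite -lee_fin -diamE; exact: eucl_diam_ge.
have Ecl : closed E by apply: compact_closed => //; exact: norm_hausdorff.
have [mu [v [sigma [mu_compl muT /andP[sig0 sigC] [v01 vS vlip] [mu_up mu_lo]]]]] :=
  exists_ball_measure n_gt0 d_gt0 c10 delta0 Ebd Ec Ex0 diamE Ereg.
have DE k Q x : D k Q -> Q x -> E x.
  by move=> DQ Qx; have [<- _ _] := Dpart k; exists Q.
exists mu; rewrite diamE; split.
- exact: (support_eq delta0 sig0 cl0 v01 mu_lo mu_compl Ecl).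
- rewrite -muT -(setUv E) -[LHS]adde0 -mu_compl; apply: esym; apply: measureU.
  + exact: borel_closed Ecl.
  + exact: borel_open (closed_openC Ecl).
  + exact: setICr.
- move=> x r Ex r0; rewrite lte_fin => rd.
  exact: (ball_growth delta0 sig0 sigC cu0 v01 mu_up).
- move=> x r Ex r0; rewrite lte_fin => rd.
  exact: (ball_doubling delta0 B0 sig0 cu0 cl0 vS mu_up mu_lo).
- move=> j k P Q DP DQ PQ; rewrite -EFinM lee_fin => kd.
  have [xP [PxP _ PB]] := Dball _ _ DP.
  have [xQ [QxQ QB1 QB2]] := Dball _ _ DQ.
  exact: (density_monotone delta0 B0 sig0 cu0 cl0 v01 vS vlip mu_up mu_lo mu_compl Ecl
    (DE _ _ _ DP PxP) (DE _ _ _ DQ QxQ) PB PxP QB1 QB2 PQ kd).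
Qed.
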